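(* Let $1\leq m\leq n-1$ be integers, let $s\in[m,n]$, and let $t\in[0,s)$. Suppose $E\subseteq\mathbb{R}^n$ is a $t$-set and $$\liminf_{r\downarrow 0} \frac{\mathcal{H}^t(E\cap B(x,r))}{r^t}>0\quad\text{at $\mathcal{H}^t$-a.e. $x\in E$}.$$ Then $E$ is countably $(\mathcal{H}^t,m\rightarrow s)$ rectifiable, i.e. there exist countably many $(m/s)$-Hölder $m$-cubes $\Gamma_i\subseteq\mathbb{R}^n$ such that $\mathcal{H}^t(E\setminus \bigcup_i \Gamma_i)=0$. Moreover, if $t\in[0,1)$, then $E$ is countably $(\mathcal{H}^t,1)$ bi-Lipschitz rectifiable, i.e. there exist countably many bi-Lipschitz embeddings $f_i:[0,1]\rightarrow\mathbb{R}^n$ such that $\mathcal{H}^t(E\setminus \bigcup_i f_i([0,1]))=0$.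
   Context: $\mathcal{H}^t$ denotes $t$-dimensional Hausdorff measure on $\mathbb{R}^n$. A $t$-set is an $\mathcal{H}^t$-measurable set $E\subseteq\mathbb{R}^n$ with $0<\mathcal{H}^t(E)<\infty$. $B(x,r)$ is the closed ball with center $x$ and radius $r$. An $(m/s)$-Hölder $m$-cube is a set $f([0,1]^m)\subseteq\mathbb{R}^n$, where $f:[0,1]^m\to\mathbb{R}^n$ satisfies $\sup_{x\ne y}|f(x)-f(y)|/|x-y|^{m/s}<\infty$. A bi-Lipschitz embedding $f:[0,1]\to\mathbb{R}^n$ is a map for which there is $1\le L<\infty$ with $L^{-1}|x-y|\le |f(x)-f(y)|\le L|x-y|$ for all $x,y\in[0,1]$. *)

(* Defs.v *)
From HB Require Import structures.
From mathcomp Require Import all_boot all_order all_algebra.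
From mathcomp Require Import all_classical all_reals all_analysis.

Set Implicit Arguments.
Unset Strict Implicit.
Unset Printing Implicit Defensive.

Import Order.TTheory GRing.Theory Num.Theory.
Import numFieldNormedType.Exports.

Local Open Scope classical_set_scope.
Local Open Scope ring_scope.

(* The Euclidean norm: the norm `|x| that the library puts on row vectors is
   the supremum norm. *)
Definition enorm (R : realType) (n : nat) (x : 'rV[R]_n) : R :=
  Num.sqrt (\sum_(i < n) x 0 i ^+ 2).

Definition eclosed_ball (R : realType) (n : nat) (x : 'rV[R]_n) (r : R) :
    set 'rV[R]_n :=
  [set y | enorm (y - x) <= r].

Definition ediam (R : realType) (n : nat) (A : set 'rV[R]_n) : \bar R :=
  ereal_sup [set (enorm (z.1 - z.2))%:E | z in A `*` A].

(* (diam A)^t with the usual conventions: the empty set contributes 0, and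
   since poweR 0 0 = 1 every nonempty set contributes 1 when t = 0, so that
   hausdorff 0 is the counting measure. *)
Definition diam_power (R : realType) (n : nat) (t : R) (A : set 'rV[R]_n) :
    \bar R :=
  if A == set0 then 0%E else poweR (ediam A) t.

Definition hausdorff_premeasure (R : realType) (n : nat) (t d : R)
    (A : set 'rV[R]_n) : \bar R :=
  ereal_inf [set (\sum_(i <oo) diam_power t (U i))%E |
    U in [set U : nat -> set 'rV[R]_n |
           (forall i, (ediam (U i) <= d%:E)%E) /\ A `<=` \bigcup_i U i]].

(* The premeasure is nonincreasing in d, so the supremum is the limit as d
   decreases to 0. *)
Definition hausdorff (R : realType) (n : nat) (t : R) (A : set 'rV[R]_n) :
    \bar R :=
  ereal_sup [set hausdorff_premeasure t d A | d in [set d : R | 0 < d]].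

Definition t_set (R : realType) (n : nat) (t : R) (E : set 'rV[R]_n) : Prop :=
  [/\ (hausdorff t).-caratheodory E, (0 < hausdorff t E)%E
    & (hausdorff t E < +oo)%E].

Definition lower_density (R : realType) (n : nat) (t : R) (E : set 'rV[R]_n)
    (x : 'rV[R]_n) : \bar R :=
  limf_einf (fun r : R =>
    (hausdorff t (E `&` eclosed_ball x r) * ((r `^ t)^-1)%:E)%E) 0^'+.

Definition hausdorff_ae_in (R : realType) (n : nat) (t : R)
    (E : set 'rV[R]_n) (P : 'rV[R]_n -> Prop) : Prop :=
  hausdorff t [set x | E x /\ ~ P x] = 0%E.

Definition unit_cube (R : realType) (m : nat) : set 'rV[R]_m :=
  [set x | forall i, 0 <= x 0 i <= 1].

Definition holder_seminorm (R : realType) (m n : nat) (a : R)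
    (D : set 'rV[R]_m) (f : 'rV[R]_m -> 'rV[R]_n) : \bar R :=
  ereal_sup [set (enorm (f z.1 - f z.2) / enorm (z.1 - z.2) `^ a)%:E |
    z in [set z : 'rV[R]_m * 'rV[R]_m | [/\ D z.1, D z.2 & z.1 <> z.2]]].

(* Only the values of f on the unit cube matter. *)
Definition holder_cube (R : realType) (n m : nat) (a : R)
    (G : set 'rV[R]_n) : Prop :=
  exists f : 'rV[R]_m -> 'rV[R]_n,
    (holder_seminorm a (@unit_cube R m) f < +oo)%E /\
    G = f @` @unit_cube R m.

Definition bilipschitz_embedding (R : realType) (n : nat)
    (f : R -> 'rV[R]_n) : Prop :=
  exists L : R, 1 <= L /\
    forall x y : R, 0 <= x <= 1 -> 0 <= y <= 1 ->
      L^-1 * `|x - y| <= enorm (f x - f y) <= L * `|x - y|.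

(* A sequence loses no generality over a countable family: cubes may be
   repeated. *)
Definition countably_holder_rectifiable (R : realType) (n : nat) (t : R)
    (m : nat) (s : R) (E : set 'rV[R]_n) : Prop :=
  exists G : nat -> set 'rV[R]_n,
    (forall i, holder_cube m (m%:R / s) (G i)) /\
    hausdorff t (E `\` \bigcup_i G i) = 0%E.

Definition countably_bilipschitz_rectifiable (R : realType) (n : nat) (t : R)
    (E : set 'rV[R]_n) : Prop :=
  exists f : nat -> R -> 'rV[R]_n,
    (forall i, bilipschitz_embedding (f i)) /\
    hausdorff t (E `\` \bigcup_i (f i @` `[0, 1])) = 0%E.

(* Main.v *)
(* Proof idea.  A Vitali argument shows that the upper density of E is finite almost
   everywhere, so up to a null set E is a countable union of bounded pieces A on which
   the measure of small balls centred in A is comparable to r^t; hence at most C (r/e)^t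
   points of A that are e-apart fit into a set of diameter r.

   Both claims then come from embeddings of A in the line.  Given nested partitions of A
   with compatible linear orders on the cells, let c_k(a) be the number of k-th cells that
   precede the cell of a, and put u(a) = sum_k w^k c_k(a).  Points separated at stage k
   have |u(a) - u(b)| >= w^k, and the cell count makes the tail after stage k at most
   C w^k as soon as w 2^t < 1.

   Hoelder part: use dyadic cells ordered lexicographically and w = 2^(-s1), t < s1 < s.
   Then |a - b|^s1 <= C |u(a) - u(b)|.  Distributing the binary digits of u over m
   coordinates, with digit weight 2^(-s/s1) < 1/2, loses the exponent s/s1 > 1 and
   produces P(a) in the unit m-cube with |a - b| <= C |P(a) - P(b)|^(m/s); the map
   P(a) |-> a extends to the cube by McShane's formula.

   Bi-Lipschitz part: when t < 1 the coordinate projections of a cell of diameter K/2^k have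
   gaps of length comparable to K/2^k, cutting it into cells of half the diameter.  With
   w = 1/2 the map u is bi-Lipschitz on A.  Ordering by the last coordinate after all the
   others makes u increase along pairs a, b that differ mostly in the last coordinate,
   that is, x_a - x_b <= psi(u(a) - u(b)) + L |y_a - y_b| with psi strictly increasing and
   sublinear, where x is the last coordinate and y the others.  Extending first y as a
   function h of u and then x as a function of (u, y), by an asymmetric version of
   McShane's formula, gives the bi-Lipschitz arc v |-> (x(v, h(v)), h(v)) through A. *)

Require Import Defs.
From mathcomp Require Import all_boot all_order all_algebra.
From mathcomp Require Import all_classical all_reals all_analysis.
From mathcomp Require Import ring lra zify.

Import Order.TTheory GRing.Theory Num.Theory.
Import numFieldNormedType.Exports.

Local Open Scope classical_set_scope.
Local Open Scope ring_scope.

(** * The sum norm and the Euclidean norm on row vectors *)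

Section Norms.
Context {R : realType} {n : nat}.
Implicit Types x y : 'rV[R]_n.

Definition lnorm x : R := \sum_i `|x 0 i|.

Lemma lnorm_ge0 x : 0 <= lnorm x.
Proof. by apply: sumr_ge0 => i _. Qed.

Lemma lnormD x y : lnorm (x + y) <= lnorm x + lnorm y.
Proof. by rewrite /lnorm -big_split /=; apply: ler_sum => i _; rewrite !mxE ler_normD. Qed.

Lemma lnorm0 : lnorm 0 = 0.
Proof. by rewrite /lnorm big1 // => i _; rewrite mxE normr0. Qed.

Lemma coord_le_lnorm x i : `|x 0 i| <= lnorm x.
Proof. by rewrite /lnorm (bigD1 i) //= lerDl sumr_ge0. Qed.

Lemma enorm_ge0 x : 0 <= enorm x.
Proof. exact: sqrtr_ge0. Qed.

Lemma enorm_distC x y : enorm (x - y) = enorm (y - x).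
Proof.
by congr (Num.sqrt _); apply: eq_bigr => i _; rewrite !mxE -sqrrN opprB.
Qed.

Lemma coord_le_enorm x i : `|x 0 i| <= enorm x.
Proof.
rewrite -sqrtr_sqr ler_wsqrtr // (bigD1 i) //= lerDl.
by apply: sumr_ge0 => j _; apply: sqr_ge0.
Qed.

Lemma enorm_le_lnorm x : enorm x <= lnorm x.
Proof.
rewrite -[leRHS]ger0_norm ?lnorm_ge0 // -sqrtr_sqr ler_wsqrtr //.
rewrite expr2 {1}/lnorm mulr_suml; apply: ler_sum => i _.
by rewrite -real_normK ?num_real // expr2 ler_wpM2l // coord_le_lnorm.
Qed.

Lemma lnorm_le_coord x (M : R) : (forall i, `|x 0 i| <= M) -> lnorm x <= n%:R * M.
Proof.
move=> xM; apply: (le_trans (ler_sum _ (fun i _ => xM i))).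
by rewrite sumr_const card_ord mulr_natl.
Qed.

Lemma lnorm_le_enorm x : lnorm x <= n%:R * enorm x.
Proof. by apply: lnorm_le_coord => i; apply: coord_le_enorm. Qed.

End Norms.

(** * Lexicographic weak orders and ranks *)

Section RankOrder.
Context {T : Type}.
Implicit Types (lt P : rel T) (a b c : T).

(** A strict weak order, with negative transitivity in place of transitivity. Incomparability is
    then an equivalence relation, and its classes play the part of cells. *)
Definition weak_order lt :=
  (forall a b, lt a b -> ~~ lt b a) /\
  (forall a b c, lt a b -> lt a c || lt c b).

Definition incomparable lt : rel T := fun a b => ~~ lt a b && ~~ lt b a.

Lemma weak_order_irr lt a : weak_order lt -> lt a a = false.
Proof. by case=> asym _; apply/negP => aa; have := asym _ _ aa; rewrite aa. Qed.

Lemma weak_order_trans lt b a c : weak_order lt -> lt a b -> lt b c -> lt a c.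
Proof.
move=> [asym cot] ab bc; case/orP: (cot _ _ c ab) => // cb.
by have := asym _ _ cb; rewrite bc.
Qed.

Lemma incomparable_sym lt a b : incomparable lt a b = incomparable lt b a.
Proof. by rewrite /incomparable andbC. Qed.

Lemma incomparable_trans lt b a c : weak_order lt ->
  incomparable lt a b -> incomparable lt b c -> incomparable lt a c.
Proof.
move=> [_ cot] /andP[ab ba] /andP[bc cb]; apply/andP; split; apply/negP.
  by move=> /(cot _ _ b)/orP[]; apply/negP.
by move=> /(cot _ _ b)/orP[]; apply/negP.
Qed.

Lemma incomparable_ltl lt a b c : weak_order lt ->
  incomparable lt a b -> lt a c -> lt b c.
Proof.
by move=> [_ cot] /andP[/negP ab _] /(cot _ _ b) /orP[].
Qed.

Lemma incomparable_ltr lt a b c : weak_order lt ->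
  incomparable lt a b -> lt c a -> lt c b.
Proof.
by move=> [_ cot] /andP[_ /negP ba] /(cot _ _ b) /orP[].
Qed.

Definition refine lt P : rel T := fun a b => lt a b || incomparable lt a b && P a b.

Lemma refine_incomparable lt P a b :
  incomparable (refine lt P) a b = [&& incomparable lt a b, ~~ P a b & ~~ P b a].
Proof.
rewrite /incomparable /refine /incomparable.
by case: (lt a b); case: (lt b a); case: (P a b); case: (P b a).
Qed.

(** The axioms are asked only inside a class of [lt], because a cut at a gap makes sense only within
    one cell. *)
Definition weak_order_on_classes lt P :=
  (forall a b, incomparable lt a b -> P a b -> ~~ P b a) /\
  (forall a b c, incomparable lt a b -> incomparable lt a c ->
    P a b -> P a c || P c b).

(** Only triples inside one class involve [P]: a point [c] that is [lt]-comparable with [a] compares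
    in the same way with every [b] incomparable to [a]. *)
Lemma weak_order_refine lt P :
  weak_order lt -> weak_order_on_classes lt P -> weak_order (refine lt P).
Proof.
move=> w [Pasym Pcot]; have [asym cot] := w; split=> [a b|a b c].
  rewrite /refine => /orP[ab|/andP[iab Pab]].
    by rewrite negb_or asym //= /incomparable ab andbF.
  rewrite negb_or incomparable_sym iab /= Pasym // andbT.
  by case/andP: iab.
rewrite /refine => /orP[ab|/andP[iab Pab]].
  by case/orP: (cot _ _ c ab) => ->; rewrite ?orbT.
have [ac|nac] := boolP (lt a c); first by [].
have [cb|ncb] := boolP (lt c b); first by rewrite !orbT.
have nca : ~~ lt c a by apply/negP => /(incomparable_ltr _ _ _ _ w iab); apply/negP.
have nbc : ~~ lt b c.
  apply/negP; rewrite incomparable_sym in iab.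
  by move=> /(incomparable_ltl _ _ _ _ w iab); apply/negP.
rewrite /= /incomparable nac ncb nca nbc /=.
by apply: Pcot => //; rewrite /incomparable nac nca.
Qed.

Variable step : nat -> rel T -> rel T.

(** [step] receives the order built so far, so that a cutting rule can look at the cell that it
    cuts. *)
Fixpoint lexi j : rel T :=
  if j is j'.+1 then refine (lexi j') (step j' (lexi j')) else fun _ _ => false.

Hypothesis stepP : forall j lt, weak_order lt -> weak_order_on_classes lt (step j lt).

Lemma weak_order_lexi j : weak_order (lexi j).
Proof.
elim: j => [|j IH] /=; first by [].
by apply: weak_order_refine => //; apply: stepP.
Qed.

Lemma lexi_mono i j a b : (i <= j)%N -> lexi i a b -> lexi j a b.
Proof.
move=> /subnK <-; elim: (j - i)%N => // k IH ab.
by rewrite addSn /= /refine IH.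
Qed.

Lemma lexi_incomparable_mono i j a b : (i <= j)%N ->
  incomparable (lexi j) a b -> incomparable (lexi i) a b.
Proof.
by move=> ij /andP[ab ba]; apply/andP; split; apply/negP => /(lexi_mono _ _ _ _ ij);
  apply/negP.
Qed.

Lemma lexi_split j a b : lexi j a b ->
  exists2 i, (i < j)%N & incomparable (lexi i) a b && step i (lexi i) a b.
Proof.
elim: j => // j IH /= /orP[/IH [i ij H]|H]; last by exists j.
by exists i => //; apply: leq_trans ij _.
Qed.

Lemma lexi_incomparable_step i j a b : (i < j)%N -> incomparable (lexi j) a b ->
  ~~ step i (lexi i) a b.
Proof.
move=> ij /(lexi_incomparable_mono _ _ _ _ ij) /=.
by rewrite refine_incomparable => /and3P[].
Qed.

End RankOrder.

Section Rank.
Context {T : Type}.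
Variables (lt : rel T) (m : nat).
Hypothesis wlt : weak_order lt.
Hypothesis chain_le : forall s, pairwise lt s -> (size s <= m)%N.

(** This counts the classes preceding that of [a]: a chain meets each class at most once. The cap
    [m] turns the count into a maximum over a finite type. *)
Definition rank (a : T) : nat :=
  \max_(p < m.+1 | `[< exists s, [/\ size s = p, pairwise lt s & all (lt^~ a) s] >]) p.

Lemma rank_chain a :
  exists s, [/\ size s = rank a, pairwise lt s & all (lt^~ a) s].
Proof.
rewrite /rank.
have : (0 < #|[pred p : 'I_m.+1 | `[< exists s, [/\ size s = p, pairwise lt s & all (lt^~ a) s] >]]|)%N.
  by apply/card_gt0P; exists ord0; apply/asboolP; exists [::].
move=> /(eq_bigmax_cond (fun p : 'I_m.+1 => p : nat)) [p /asboolP ? ->] //.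
Qed.

Lemma size_chain_le_rank a s : pairwise lt s -> all (lt^~ a) s ->
  (size s <= rank a)%N.
Proof.
move=> ps as_; have sm : (size s < m.+1)%N by rewrite ltnS chain_le.
rewrite /rank; apply: (@leq_bigmax_cond _ _ (fun p : 'I_m.+1 => p : nat) (Ordinal sm)).
by apply/asboolP; exists s.
Qed.

Lemma rank_lt a b : lt a b -> (rank a < rank b)%N.
Proof.
move=> ab; have [s [<- ps as_]] := rank_chain a.
have := @size_chain_le_rank b (rcons s a); rewrite size_rcons; apply.
  by rewrite pairwise_rcons ps andbT.
rewrite all_rcons ab /=; apply: sub_all as_ => x xa.
exact: weak_order_trans wlt xa ab.
Qed.

(** A longest chain below [b] splits into its members below [a], of which there are at most
    [rank a], and the remaining ones. *)
Lemma rank_between a b : exists s, [/\ pairwise lt s,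
  all (fun x => ~~ lt x a && lt x b) s & (rank b <= rank a + size s)%N].
Proof.
have [s [<- ps bs]] := rank_chain b.
exists [seq x <- s | ~~ lt x a]; split; first by rewrite pairwise_filter.
  by rewrite all_filter; apply: sub_all bs => x xb /=; apply/implyP => ->.
have := count_predC (lt^~ a) s; rewrite -!size_filter => <-.
rewrite leq_add2r; apply: size_chain_le_rank; last exact: filter_all.
exact: pairwise_filter.
Qed.

Lemma rank_incomparable a b : incomparable lt a b -> rank a = rank b.
Proof.
have le c d : incomparable lt c d -> (rank d <= rank c)%N.
  move=> cd; have [[|x s] [_ + H]] := rank_between c d; first by rewrite addn0 in H.
  move=> /= /andP[/andP[/negP nxc xd] _].
  exfalso; apply: nxc; rewrite incomparable_sym in cd.
  exact: incomparable_ltr wlt cd xd.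
by move=> ab; apply/eqP; rewrite eqn_leq !le // incomparable_sym.
Qed.

End Rank.

Lemma cvgn_ge {R : realType} (f : nat -> R) (l x : R) (N : nat) :
  f n @[n --> \oo] --> l -> (forall n, (N <= n)%N -> x <= f n) -> x <= l.
Proof.
move=> fl fx; rewrite -(cvg_lim (@Rhausdorff R) fl); apply: limr_ge.
  by apply/cvg_ex; exists l.
by exists N => // n /= /fx.
Qed.

Lemma cvgn_le {R : realType} (f : nat -> R) (l x : R) (N : nat) :
  f n @[n --> \oo] --> l -> (forall n, (N <= n)%N -> f n <= x) -> l <= x.
Proof.
move=> fl fx; rewrite -(cvg_lim (@Rhausdorff R) fl); apply: limr_le.
  by apply/cvg_ex; exists l.
by exists N => // n /= /fx.
Qed.

(** * Embedding in the line from a nested sequence of weak orders *)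

Section RankEmbedding.
Context {R : realType} {T : Type}.
Variables (L : nat -> rel T) (w b B : R).
Hypothesis wL : forall k, weak_order (L k).
Hypothesis L0 : forall x y, L 0%N x y = false.
Hypothesis Lmono : forall i j x y, (i <= j)%N -> L i x y -> L j x y.
Hypothesis w0 : 0 < w.
Hypothesis b1 : 1 <= b.
Hypothesis wb1 : w * b < 1.
Hypothesis B0 : 0 <= B.
(** A chain picks at most one point per cell, so this bounds the number of stage-[k] cells inside
    one stage-[j] cell. *)
Hypothesis chain_le : forall j k s, (j <= k)%N -> pairwise (L k) s ->
  pairwise (incomparable (L j)) s -> (size s)%:R <= B * b ^+ (k - j).

Let Lincmono i j x y : (i <= j)%N -> incomparable (L j) x y -> incomparable (L i) x y.
Proof.
by move=> ij /andP[xy yx]; apply/andP; split; apply/negP => /(Lmono _ _ _ _ ij);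
  apply/negP.
Qed.

Let m k := Num.bound (B * b ^+ k).

Let chain_le_m k s : pairwise (L k) s -> (size s <= m k)%N.
Proof.
move=> ps; rewrite -(ler_nat R); apply: (@le_trans _ _ (B * b ^+ k)).
  rewrite -[k in b ^+ k]subn0; apply: chain_le => //.
  by apply: sub_pairwise ps => x y _; rewrite /incomparable !L0.
apply: ltW; apply: archi_boundP.
by rewrite mulr_ge0 // exprn_ge0 // (le_trans _ b1).
Qed.

Let c k := rank (L k) (m k).

Let c_mono k x y : ~~ L k y x -> (c k x <= c k y)%N.
Proof.
move=> yx; have [xy|xy] := boolP (L k x y).
  by apply: ltnW; apply: rank_lt => // s; apply: chain_le_m.
rewrite /c (@rank_incomparable _ _ _ _ _ x y) // ?/incomparable ?xy //.
exact: chain_le_m.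
Qed.

(** A point that at stage [k] comes before [y] but not before [x] still lies in the common stage-[j]
    cell of [x] and [y], so [chain_le] applies to the chain given by [rank_between]. *)
Let c_le j k x y : (j <= k)%N -> incomparable (L j) x y ->
  (c k y)%:R <= (c k x)%:R + B * b ^+ (k - j).
Proof.
move=> jk xy; have [s [ps bs sy]] := rank_between _ _ (@chain_le_m k) x y.
apply: (@le_trans _ _ ((c k x + size s)%N%:R)); first by rewrite ler_nat.
rewrite natrD lerD2l; apply: chain_le => //.
have incx z : ~~ L k z x && L k z y -> incomparable (L j) x z.
  move=> /andP[nzx zy]; apply/andP; split; apply/negP.
    move=> xz; have yz : L j y z by apply: incomparable_ltl xz.
    by have [asym _] := wL k; have := asym _ _ (Lmono _ _ _ _ jk yz); rewrite zy.
  by move=> /(Lmono _ _ _ _ jk); apply/negP.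
elim: s {ps sy} bs => //= z s IH /andP[hz hs]; rewrite IH // andbT.
apply: sub_all hs => z' hz'; apply: (@incomparable_trans _ _ x) => //.
  by rewrite incomparable_sym; apply: incx.
exact: incx.
Qed.

Let term x k := w ^+ k * (c k x)%:R.

Let c_bound k x : (c k x)%:R <= B * b ^+ k.
Proof.
have [s [sc ps _]] := rank_chain (L k) (m k) x.
rewrite /c -sc -[k in b ^+ k]subn0; apply: chain_le => //.
by apply: sub_pairwise ps => z y _; rewrite /incomparable !L0.
Qed.

Let w_ge0 : 0 <= w. Proof. exact: ltW. Qed.
Let b_ge0 : 0 <= b. Proof. exact: le_trans b1. Qed.
Let wb_ge0 : 0 <= w * b. Proof. exact: mulr_ge0. Qed.

Let term_cvg x : cvgn (series (term x)).
Proof.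
apply: (@series_le_cvg _ _ (geometric B (w * b))).
- by move=> k; rewrite mulr_ge0 // exprn_ge0.
- by move=> k; apply: geometric_ge0.
- move=> k; rewrite /term /geometric /= exprMn mulrCA ler_wpM2l ?exprn_ge0 //.
- by apply: is_cvg_geometric_series; rewrite ger0_norm.
Qed.

Let u x := limn (series (term x)).

Let series_diff_cvg x y :
  (series (term y) n - series (term x) n) @[n --> \oo] --> u y - u x.
Proof. by apply: cvgB; apply: term_cvg. Qed.

(** The orders are nested, so no stage puts [y] before [x] and every term of the difference of the
    series is nonnegative; stage [k] alone contributes at least [w ^+ k]. *)
Let u_lower k x y : L k x y -> u x + w ^+ k <= u y.
Proof.
move=> xy; rewrite addrC -lerBrDr.
apply: (@cvgn_ge _ _ _ _ k.+1 (@series_diff_cvg x y)) => n kn.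
rewrite /series /= -sumrB.
rewrite big_mkord (bigD1 (Ordinal kn)) //= -[leLHS]addr0.
rewrite lerD //.
  rewrite /term -mulrBr ler_peMr ?exprn_ge0 // lerBrDl natr1 ler_nat.
  apply: rank_lt => // s; exact: chain_le_m.
apply: sumr_ge0 => i _; rewrite /term -mulrBr mulr_ge0 ?exprn_ge0 // subr_ge0 ler_nat.
apply: c_mono; apply/negP => yx.
have [ik|/ltnW ki] := leqP i k.
  by have [a _] := wL k; have := a _ _ xy; rewrite (Lmono _ _ _ _ ik yx).
by have [a _] := wL i; have := a _ _ yx; rewrite (Lmono _ _ _ _ ki xy).
Qed.

(** The terms before [k] cancel because the ranks agree there; the tail is dominated by a geometric
    series of ratio [w * b]. *)
Let u_upper_half k x y : incomparable (L k) x y ->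
  u y - u x <= w ^+ k * B / (1 - w * b).
Proof.
move=> xy; apply: (@cvgn_le _ _ _ _ k (@series_diff_cvg x y)) => n kn.
rewrite /series /= -sumrB.
rewrite (big_cat_nat (n := k)) //= [X in X + _]big1_seq ?add0r; last first.
  move=> i; rewrite mem_index_iota /= => ik; apply/eqP; rewrite subr_eq0 /term /c.
  rewrite (@rank_incomparable _ _ _ _ _ x y) //; first exact: chain_le_m.
  by apply: Lincmono xy; apply: ltnW.
rewrite -{1}[k]add0n big_addn.
apply: (@le_trans _ _ (\sum_(0 <= i < n - k) w ^+ k * B * (w * b) ^+ i)).
  apply: ler_sum => i _; rewrite /term -mulrBr addnC exprD exprMn -!mulrA.
  rewrite ler_wpM2l ?exprn_ge0 // mulrCA ler_wpM2l ?exprn_ge0 // lerBlDl.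
  by rewrite -[i in b ^+ i](addKn k); apply: c_le; rewrite // leq_addr.
have [-> | wb_neq0] := eqVneq (w * b) 0.
  rewrite subr0 divr1; case: (n - k)%N => [|p].
    by rewrite big_geq // mulr_ge0 ?exprn_ge0.
  rewrite big_nat_recl //= expr0 mulr1 big1 ?addr0 // => i _.
  by rewrite expr0n mulr0.
have := @geometric_le_lim R (n - k) (w ^+ k * B) (w * b).
by rewrite /series /geometric /=; apply; rewrite ?mulr_ge0 ?exprn_ge0 ?ger0_norm // lt0r wb_neq0.
Qed.

Lemma rank_embedding : exists u : T -> R,
  (forall k x y, L k x y -> u x + w ^+ k <= u y) /\
  (forall k x y, incomparable (L k) x y -> `|u x - u y| <= w ^+ k * B / (1 - w * b)).
Proof.
exists u; split=> [k x y|k x y xy]; first exact: u_lower.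
rewrite ler_norml lerNl opprB !u_upper_half //.
by rewrite incomparable_sym.
Qed.

End RankEmbedding.

(** * Hölder cubes *)

Section Packing.
Context {R : realType} {n : nat}.
Implicit Types x y z : 'rV[R]_n.

Definition apart (e : R) : rel 'rV[R]_n :=
  fun x y => [exists i, e <= `|x 0 i - y 0 i|].

Definition close (e : R) : rel 'rV[R]_n :=
  fun x y => [forall i, `|x 0 i - y 0 i| <= e].

(** Both [apart] and [close] refer to the supremum norm. The restriction [e <= 1] mirrors the lower
    mass bounds, which are available only at radii up to 1. *)
Definition packing {T : Type} (t : R) (X : T -> 'rV[R]_n) : Prop :=
  exists2 C : R, 0 <= C & forall (e r : R) (s : seq T), 0 < e <= 1 -> e <= r ->
    pairwise (relpre X (apart e)) s -> pairwise (relpre X (close r)) s ->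
    (size s)%:R <= C * (r / e) `^ t.

End Packing.

(** The extension is [F z = inf_a (f a + rho z (p a))]. Here [rho] may be asymmetric and may take
    negative values, which the construction of arcs exploits. *)
Lemma mcshane {R : realType} {I Z : Type} (rho : Z -> Z -> R) (p : I -> Z)
    (f : I -> R) (a0 : I) :
  (forall z, rho z z = 0) ->
  (forall x y z, rho x z <= rho x y + rho y z) ->
  (forall a b, f a - f b <= rho (p a) (p b)) ->
  exists F : Z -> R, (forall z w, F z - F w <= rho z w) /\
    (forall a, F (p a) = f a).
Proof.
move=> rho0 tri Lf.
pose S z := [set f a + rho z (p a) | a in setT].
(* Each sample point [a] bounds the set below, by the triangle inequality through [z]; hence the
   infimum is finite. *)
have S_lb z a : lbound (S z) (f a - rho (p a) z).
  move=> _ [b _ <-]; have := Lf a b; have := tri (p a) z (p b); lra.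
have S_inf z : has_inf (S z).
  split; first by exists (f a0 + rho z (p a0)), a0.
  by exists (f a0 - rho (p a0) z); apply: S_lb.
have F_le z a : inf (S z) <= f a + rho z (p a).
  by apply: ge_inf; [case: (S_inf z)|exists a].
exists (fun z => inf (S z)); split=> [z w|a].
  suff : inf (S z) - rho z w <= inf (S w) by lra.
  apply: lb_le_inf; first by case: (S_inf w).
  move=> _ [a _ <-]; have := F_le z a; have := tri z w (p a); lra.
apply/eqP; rewrite eq_le; apply/andP; split.
  by have := F_le (p a) a; rewrite rho0 addr0.
apply: lb_le_inf; first by case: (S_inf (p a)).
move=> _ [b _ <-]; have := Lf a b; lra.
Qed.

Lemma half_pow_lt {R : realType} (K e : R) : 0 < e -> exists k : nat, K * 2^-1 ^+ k < e.
Proof.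
move=> e0; pose k := Num.bound (Num.max 0 (K / e)); exists k.
rewrite exprVn ltr_pdivrMr ?exprn_gt0 // -ltr_pdivrMl // mulrC.
apply: (@lt_le_trans _ _ k%:R).
  apply: (@le_lt_trans _ _ (Num.max 0 (K / e))); first by rewrite le_max lexx orbT.
  by apply: archi_boundP; rewrite le_max lexx.
by rewrite -natrX ler_nat ltnW // ltn_expl.
Qed.

Lemma size_colour {T : Type} {C : finType} (col : T -> C) (s : seq T) :
  size s = \sum_(c : C) count (fun x => col x == c) s.
Proof.
elim: s => [|x s IH] /=; first by rewrite big1.
rewrite big_split /= -IH -add1n; congr (_ + _)%N.
rewrite (bigD1 (col x)) //= eqxx big1 ?addn0 // => c /negbTE.
by rewrite eq_sym => ->.
Qed.

(** A fine cell determines the coarse cell around it: if [floor b < floor a], then the integer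
    [M * floor a] lies above [M * b] and not above [M * a], so the floors of the multiples
    differ. *)
Lemma floor_mul_eq {R : realType} (M : nat) (y z : R) : (0 < M)%N ->
  Num.floor (M%:R * y) = Num.floor (M%:R * z) -> Num.floor y = Num.floor z.
Proof.
move=> M0 H; apply/eqP; rewrite eq_le; apply/andP.
have key (a b : R) : Num.floor (M%:R * a) = Num.floor (M%:R * b) -> Num.floor a <= Num.floor b.
  move=> ab; rewrite leNgt; apply/negP => ba.
  have M0' : 0 < M%:R :> R by rewrite ltr0n.
  have /andP[a1 a2] := floor_itv a; have /andP[b1 b2] := floor_itv b.
  have /andP[c1 c2] := floor_itv (M%:R * a); have /andP[d1 d2] := floor_itv (M%:R * b).
  have ba' : (Num.floor b + 1)%:~R <= (Num.floor a)%:~R :> R by rewrite ler_int; lia.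
  have : (Num.floor (M%:R * b))%:~R < (M%:Z * Num.floor a)%:~R :> R.
    apply: le_lt_trans d1 _; rewrite intrM ltr_pM2l //; exact: lt_le_trans ba'.
  have : (M%:Z * Num.floor a)%:~R < (Num.floor (M%:R * a) + 1)%:~R :> R.
    by apply: le_lt_trans c2; rewrite intrM ler_pM2l.
  rewrite !ltr_int ab; lia.
by split; apply: key.
Qed.

(** * Dyadic cubes and an embedding in the line with Hölder inverse *)

Section Dyadic.
Context {R : realType} {n' : nat} {T : Type}.
Let n := n'.+1.
Variables (X : T -> 'rV[R]_n).

Definition dyadic_cell (k : nat) (a : T) (i : 'I_n) : int :=
  Num.floor (2 ^+ k * X a 0 i).

(** Step [j] treats coordinate [j %% n] at level [j %/ n], so [n] consecutive steps exhaust one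
    level. *)
Definition dyadic_step (j : nat) (_ : rel T) : rel T := fun a b =>
  dyadic_cell (j %/ n) a (inord (j %% n)) < dyadic_cell (j %/ n) b (inord (j %% n)).

Lemma dyadic_stepP j lt : weak_order lt -> weak_order_on_classes lt (dyadic_step j lt).
Proof.
by move=> _; split; rewrite /dyadic_step => *; lia.
Qed.

(** After [k * n] steps the levels below [k] are exhausted; thus the classes at stage [k.+1] are
    traces of cubes of side [2^-k]. *)
Definition dyadic_lt (k : nat) : rel T := lexi dyadic_step (k * n).

Lemma dyadic_incomparable k k' a b i : (k' < k)%N ->
  incomparable (dyadic_lt k) a b -> dyadic_cell k' a i = dyadic_cell k' b i.
Proof.
move=> kk'.
have jk : (k' * n + i < k * n)%N.
  by apply: (@leq_trans (k'.+1 * n)); rewrite ?leq_mul2r ?kk' ?orbT // mulSn addnC ltn_add2r.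
have dE : ((k' * n + i) %/ n = k')%N by rewrite divnMDl // divn_small // addn0.
have mE : inord ((k' * n + i) %% n) = i.
  by apply: val_inj; rewrite /= modnMDl modn_small // inordK.
move=> ab; have := @lexi_incomparable_step _ _ _ _ _ _ jk ab.
rewrite incomparable_sym in ab; have := @lexi_incomparable_step _ _ _ _ _ _ jk ab.
rewrite /dyadic_step dE mE; lia.
Qed.

(** The separation may occur at a coarser level; by [floor_mul_eq] it persists at level [k]. *)
Lemma dyadic_lt_cell k a b : dyadic_lt k.+1 a b -> exists i, dyadic_cell k a i != dyadic_cell k b i.
Proof.
move=> ab; have [j jk /andP[_]] := lexi_split _ _ _ _ ab; rewrite /dyadic_step.
set k' := (j %/ n)%N; set i := inord _ => cell; exists i.
have k'k : (k' <= k)%N by rewrite -ltnS /k' ltn_divLR.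
apply/eqP; rewrite /dyadic_cell -(subnK k'k) exprD -!mulrA -natrX => H.
by move: cell; rewrite /dyadic_cell (floor_mul_eq _ _ _ _ H) ?ltxx // expn_gt0.
Qed.

Lemma same_cell_close k a b : (forall i, dyadic_cell k a i = dyadic_cell k b i) ->
  close (2^-1 ^+ k) (X a) (X b).
Proof.
move=> H; apply/forallP => i; have := H i; rewrite /dyadic_cell => Hi.
have p0 : 0 < 2 ^+ k :> R by rewrite exprn_gt0.
rewrite exprVn -(ler_pM2l p0) mulfV ?gt_eqF // -[2 ^+ k in leLHS]gtr0_norm // -normrM mulrBr.
have := floor_itv (2 ^+ k * X a 0 i); have := floor_itv (2 ^+ k * X b 0 i).
rewrite Hi intrD => /andP[h1 h2] /andP[h3 h4].
by rewrite ler_norml; apply/andP; split; lra.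
Qed.

(* Points in adjacent cells may be arbitrarily close; distinct cells of equal parity
   are a full side length apart. *)
Definition dyadic_parity k a : {ffun 'I_n -> bool} :=
  [ffun i => (dyadic_cell k a i %% 2)%Z == 0].

Lemma same_parity_apart k a b : dyadic_parity k a = dyadic_parity k b ->
  (exists i, dyadic_cell k a i != dyadic_cell k b i) ->
  apart (2^-1 ^+ k) (X a) (X b).
Proof.
move=> par [i Hi]; apply/existsP; exists i.
have p0 : 0 < 2 ^+ k :> R by rewrite exprn_gt0.
rewrite exprVn -(ler_pM2l p0) mulfV ?gt_eqF // -[2 ^+ k in leRHS]gtr0_norm // -normrM mulrBr.
have := congr1 (fun f : {ffun 'I_n -> bool} => f i) par; rewrite !ffunE.
move: Hi; rewrite /dyadic_cell.
have := floor_itv (2 ^+ k * X a 0 i); have := floor_itv (2 ^+ k * X b 0 i).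
set p := Num.floor _; set q := Num.floor _ => /andP[h1 h2] /andP[h3 h4] pq par2.
have : q + 2 <= p \/ p + 2 <= q by lia.
case=> h; move: h; rewrite -(ler_int R) !intrD => h.
  by rewrite ler_normr; apply/orP; right; move: h2 h3 h4 h1; rewrite !intrD; lra.
by rewrite ler_normr; apply/orP; left; move: h2 h3 h4 h1; rewrite !intrD; lra.
Qed.

End Dyadic.

Lemma powR_exprn {R : realType} (x p : R) (k : nat) : 0 <= x ->
  (x ^+ k) `^ p = (x `^ p) ^+ k.
Proof.
by move=> x0; rewrite -powR_mulrn // -powRrM mulrC powRrM powR_mulrn // powR_ge0.
Qed.

Lemma ler_powR_base {R : realType} (x y p : R) : 0 <= p -> 0 <= x -> x <= y ->
  x `^ p <= y `^ p.
Proof. by move=> p0 x0 xy; apply: ge0_ler_powR; rewrite ?nnegrE // (le_trans x0). Qed.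

Lemma half_powR_lt1 {R : realType} (p : R) : 0 < p -> 2^-1 `^ p < 1 :> R.
Proof.
move=> p0; suff : 2^-1 `^ p < 1 `^ p :> R by rewrite powR1.
by apply: (gt0_ltr_powR p0); rewrite ?nnegrE ?invr_ge0 // invf_lt1 // ltr1n.
Qed.

Lemma half_powRM {R : realType} (t s : R) : 2^-1 `^ s * 2 `^ t = 2^-1 `^ (s - t) :> R.
Proof.
have -> : 2^-1 `^ s = 2^-1 `^ (s - t) * 2^-1 `^ t :> R.
  rewrite -powRD ?subrK //; apply/implyP => _; by rewrite invr_eq0 pnatr_eq0.
by rewrite -mulrA -powRM // mulVf // powR1 mulr1.
Qed.

Lemma close_le {R : realType} {n : nat} (e e' : R) (x y : 'rV[R]_n) :
  e <= e' -> close e x y -> close e' x y.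
Proof.
by move=> ee' /forallP xy; apply/forallP => i; apply: le_trans (xy i) ee'.
Qed.

(** Two points first separated at stage [k.+1] are within a multiple of [2^-k] of each other, while
    [u] separates them by [w^(k+1) = 2^(-s(k+1))]. The weights are admissible because
    [w * 2^t = 2^(t-s) < 1]. *)
Lemma dyadic_embedding {R : realType} {n' : nat} {T : Type}
    (X : T -> 'rV[R]_n'.+1) (K t s : R) : 0 <= t < s ->
  (forall a b, close K (X a) (X b)) -> packing t X ->
  exists (u : T -> R) (S c : R), [/\ 0 <= c,
    forall a b, `|u a - u b| <= S
    & forall a b i, `|X a 0 i - X b 0 i| `^ s <= c * `|u a - u b|].
Proof.
move=> /andP[t0 ts] XK [C C0 Cpack].
have s0 : 0 < s by exact: le_lt_trans ts.
(* At stage 0 the diameter bound is [K]; at stage [k.+1] the side is [2^-k = 2 * 2^-(k+1)], which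
   accounts for the 2. *)
pose L := dyadic_lt X; pose K' := Num.max 2 K.
have K'2 : 2 <= K' by rewrite le_max lexx.
have wL k : weak_order (L k).
  by apply: weak_order_lexi => j lt; apply: dyadic_stepP.
have L0 a b : L 0%N a b = false by [].
have Lmono i j a b : (i <= j)%N -> L i a b -> L j a b.
  by move=> ij; apply: lexi_mono; rewrite leq_mul2r ij orbT.
have L_close k a b : incomparable (L k) a b -> close (K' * 2^-1 ^+ k) (X a) (X b).
  case: k => [_|k ab].
    by rewrite expr0 mulr1; apply: close_le (XK a b); rewrite le_max lexx orbT.
  have := @same_cell_close _ _ _ X k a b.
  move=> /(_ (fun i => dyadic_incomparable _ _ _ _ _ i (ltnSn k) ab)).
  apply: close_le; rewrite exprS mulrA ler_peMl ?exprn_ge0 //; lra.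
pose b : R := 2 `^ t; pose w : R := 2^-1 `^ s.
pose N := #|{: {ffun 'I_n'.+1 -> bool}}|.
(* One packing bound for each of the [N] parity colours; the summand 1 covers stage 0, where a chain
   has at most one point. *)
pose B := 1 + N%:R * (C * K' `^ t).
have b1 : 1 <= b by rewrite /b -[leLHS](powRr0 2) ler_powR //; lra.
have w0 : 0 < w by rewrite powR_gt0.
have wb1 : w * b < 1 by rewrite /w /b half_powRM half_powR_lt1 // subr_gt0.
have CK0 : 0 <= C * K' `^ t by rewrite mulr_ge0 ?powR_ge0.
have B1 : 1 <= B by rewrite lerDl mulr_ge0.
have chain j k (l : seq T) : (j <= k)%N -> pairwise (L k) l ->
    pairwise (incomparable (L j)) l -> (size l)%:R <= B * b ^+ (k - j).
  move=> jk pl il.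
  have bkj : 1 <= b ^+ (k - j) by rewrite exprn_ege1.
  have [/eqP|] := posnP k.
    case: k jk pl {bkj} => // /[!leqn0] /eqP -> pl _.
    rewrite expr0 mulr1; apply: le_trans B1.
    by case: l pl il => [|x [|y l]].
  case: k jk pl bkj => // k jk pl bkj _.
  rewrite (size_colour (dyadic_parity X k) l) natr_sum.
  apply: (@le_trans _ _ (\sum_(c : {ffun 'I_n'.+1 -> bool}) (C * K' `^ t) * b ^+ (k.+1 - j))).
    apply: ler_sum => c _; rewrite -size_filter.
    set l' := [seq x <- l | dyadic_parity X k x == c].
    (* Members of one colour lie in distinct cells of equal parity, hence are [2^-k] apart, while
       their common stage-[j] class has diameter at most [K' * 2^-j]. *)
    have := Cpack (2^-1 ^+ k) (K' * 2^-1 ^+ j) l'.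
    have -> : K' * 2^-1 ^+ j / 2^-1 ^+ k = K' * 2^-1 * 2 ^+ (k.+1 - j).
      have -> : 2^-1 ^+ k = 2 * 2^-1 ^+ k.+1 :> R by rewrite exprS mulrA mulfV ?mul1r.
      rewrite -[in 2^-1 ^+ k.+1](subnK jk) exprD.
      have h1 : 2^-1 ^+ j != 0 :> R by rewrite expf_neq0 // invr_neq0.
      have h2 : 2 ^+ (k.+1 - j) != 0 :> R by rewrite expf_neq0.
      rewrite [2^-1 ^+ (k.+1 - j)]exprVn.
      move: h1 h2; move: (2^-1 ^+ j) (2 ^+ (k.+1 - j)) => x y x0 y0.
      by field; rewrite x0 y0.
    have pl' : pairwise (L k.+1) l' by apply: pairwise_filter.
    have il' : pairwise (incomparable (L j)) l' by apply: pairwise_filter.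
    move=> H; apply: (le_trans (H _ _ _ _)).
    - by rewrite exprn_gt0 //= exprn_ile1 //; lra.
    - apply: (@le_trans _ _ (2 * 2^-1 ^+ k.+1)).
        by rewrite exprS mulrA mulfV ?mul1r.
      by apply: ler_pM => //; apply: ler_wiXn2l => //; lra.
    - apply: (@sub_in_pairwise _ (fun a => dyadic_parity X k a == c) (L k.+1)) pl'.
        move=> x y /eqP xc /eqP yc /= xy; apply: same_parity_apart; first by rewrite xc yc.
        exact: dyadic_lt_cell.
      exact: filter_all.
    - by apply: sub_pairwise il' => x y; apply: L_close.
    rewrite -[leRHS]mulrA ler_wpM2l // /b -powR_exprn // -powRM ?exprn_ge0 //; last lra.
    apply: ler_powR_base => //; first by rewrite !mulr_ge0 ?exprn_ge0 //; lra.
    by rewrite ler_wpM2r ?exprn_ge0 //; lra.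
  rewrite sumr_const -mulr_natl mulrA ler_wpM2r //; first exact: le_trans bkj.
  by rewrite /B lerDr.
have [|u [ul uu]] := @rank_embedding R T L w b B wL L0 Lmono w0 b1 wb1 _ chain.
  exact: le_trans B1.
exists u, (B / (1 - w * b)), ((2 * K') `^ s); split; first exact: powR_ge0.
  by move=> a c; have := uu 0%N a c; rewrite expr0 mul1r; apply.
move=> a c i; have [->|ne] := eqVneq (X a 0 i) (X c 0 i).
  by rewrite subrr normr0 powR0 ?gt_eqF // mulr_ge0 ?powR_ge0.
have d0 : 0 < `|X a 0 i - X c 0 i| by rewrite normr_gt0 subr_eq0.
have sep : exists k, ~~ incomparable (L k) a c.
  have [k hk] := half_pow_lt K' _ d0; exists k; apply/negP => /L_close /forallP /(_ i).
  by rewrite leNgt hk.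
(* The first separating stage is [k.+1], so both points still share a class at stage [k]. *)
case: (ex_minnP sep) => -[|k]; first by rewrite /incomparable !L0.
move=> nk kmin.
have ik : incomparable (L k) a c by apply/negPn/negP => /kmin; rewrite ltnn.
have /forallP/(_ i) ci := L_close _ _ _ ik.
have wk : w ^+ k.+1 <= `|u a - u c|.
  move: nk; rewrite negb_and !negbK => /orP[|] /ul h.
    by rewrite distrC; apply: le_trans (ler_norm _); lra.
  by apply: le_trans (ler_norm _); lra.
apply: (@le_trans _ _ ((2 * K') `^ s * w ^+ k.+1)); last by rewrite ler_wpM2l ?powR_ge0.
rewrite /w -powR_exprn // -powRM ?exprn_ge0 //; last lra.
apply: ler_powR_base => //; first exact: ltW.
by apply: le_trans ci _; rewrite exprS mulrACA mulfV // mul1r.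
Qed.

(** A share [r = z / w] of the sum satisfies [r <= r^p], since [r] and [p] are at most 1; the two
    shares add up to 1. *)
Lemma ler_powRD {R : realType} (x y p : R) : 0 <= x -> 0 <= y -> 0 < p <= 1 ->
  (x + y) `^ p <= x `^ p + y `^ p.
Proof.
move=> x0 y0 /andP[p0 p1].
have key (z w : R) : 0 <= z -> 0 < w -> z <= w -> z / w * w `^ p <= z `^ p.
  move=> z0 w0 zw; have [->|zn0] := eqVneq z 0; first by rewrite !mul0r powR_ge0.
  have -> : z `^ p = (z / w) `^ p * w `^ p.
    by rewrite -powRM ?divr_ge0 // ?ltW // divfK ?gt_eqF.
  rewrite ler_wpM2r ?powR_ge0 //; apply: ger1_powR => //.
  have zp : 0 < z by rewrite lt0r zn0.
  by rewrite divr_gt0 //= ler_pdivrMr // mul1r.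
have [xy0|xyn0] := eqVneq (x + y) 0.
  by rewrite xy0 powR0 ?gt_eqF // addr_ge0 ?powR_ge0.
have w0 : 0 < x + y by rewrite lt0r xyn0 addr_ge0.
have -> : (x + y) `^ p = x / (x + y) * (x + y) `^ p + y / (x + y) * (x + y) `^ p.
  by rewrite -mulrDl -mulrDl divff ?mul1r.
by apply: lerD; apply: key; rewrite ?lerDl ?lerDr.
Qed.

(** Since [al <= 1], the function [C |z - w|^al] satisfies the triangle inequality, so each
    coordinate of [P a |-> X a] extends to the whole space by [mcshane]. *)
Lemma holder_cube_cover {R : realType} {m n : nat} {T : Type}
    (X : T -> 'rV[R]_n) (P : T -> 'rV[R]_m) (al C : R) (a0 : T) :
  0 < al <= 1 -> 0 <= C -> (forall a, unit_cube (P a)) ->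
  (forall a b i, `|X a 0 i - X b 0 i| <= C * lnorm (P a - P b) `^ al) ->
  exists2 G, holder_cube m al G & forall a, G (X a).
Proof.
move=> al01 C0 Pcube Xh; have /andP[al0 al1] := al01.
pose rho (z w : 'rV[R]_m) := C * lnorm (z - w) `^ al.
have rho0 z : rho z z = 0 by rewrite /rho subrr lnorm0 powR0 ?gt_eqF // mulr0.
have rhosym z w : rho z w = rho w z.
  rewrite /rho; congr (_ * _ `^ _); rewrite /lnorm; apply: eq_bigr => i _.
  by rewrite !mxE distrC.
have tri x y z : rho x z <= rho x y + rho y z.
  rewrite /rho -mulrDr ler_wpM2l //.
  apply: le_trans (ler_powRD _ _ _ _ _ al01); rewrite ?lnorm_ge0 //.
  apply: ler_powR_base; rewrite ?lnorm_ge0 ?(ltW al0) //.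
  by have -> : x - z = (x - y) + (y - z); [rewrite addrA subrK|apply: lnormD].
have ext i : exists F : 'rV[R]_m -> R, (forall z w, F z - F w <= rho z w) /\
    (forall a, F (P a) = X a 0 i).
  apply: mcshane => // a b; exact: le_trans (ler_norm _) (Xh a b i).
have [F HF] := choice ext.
pose f z : 'rV[R]_n := \row_i F i z.
exists (f @` @unit_cube R m); last first.
  by move=> a; exists (P a) => //; apply/rowP => i; rewrite !mxE; case: (HF i).
exists f; split => //.
pose M := n%:R * (C * m%:R `^ al).
apply: (@le_lt_trans _ _ M%:E); last exact: ltry.
apply: ge_ereal_sup => _ [[z w] /= [_ _ zw] <-]; rewrite lee_fin.
have e0 : 0 < enorm (z - w).
  rewrite lt0r enorm_ge0 andbT; apply/eqP => e0; apply: zw; apply/rowP => i.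
  apply/eqP; rewrite -subr_eq0 -normr_le0 -e0.
  by have := coord_le_enorm (z - w) i; rewrite !mxE.
rewrite ler_pdivrMr ?powR_gt0 //.
apply: le_trans (enorm_le_lnorm _) _.
rewrite /M -2!mulrA; apply: lnorm_le_coord => i; rewrite !mxE.
apply: (@le_trans _ _ (rho z w)).
  have [H _] := HF i; rewrite ler_norml lerNl opprB H andbT.
  by rewrite rhosym.
rewrite /rho ler_wpM2l // -powRM ?enorm_ge0 //.
by apply: ler_powR_base; rewrite ?lnorm_ge0 ?(ltW al0) // lnorm_le_enorm.
Qed.

(** * Binary digits and their distribution over the coordinates of a cube *)

Section BinaryDigits.
Context {R : realType}.

(** The binary digit of weight [2^-(j+1)] in the fractional part of [u]. *)
Definition bit (j : nat) (u : R) : int :=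
  Num.floor (2 ^+ j.+1 * u) - 2 * Num.floor (2 ^+ j * u).

Lemma bit01 j u : bit j u = 0 \/ bit j u = 1.
Proof.
have /andP[a1 a2] := floor_itv (2 ^+ j * u); have /andP[b1 b2] := floor_itv (2 ^+ j.+1 * u).
move: a1 a2 b1 b2; rewrite /bit exprS -mulrA.
move: (2 ^+ j * u) => v; set p := Num.floor v; set q := Num.floor (2 * v).
rewrite !intrD => a1 a2 b1 b2.
have h1 : (2 * p)%:~R < (q + 1)%:~R :> R by rewrite intrM intrD; lra.
have h2 : q%:~R < (2 * p + 2)%:~R :> R by rewrite intrD intrM; lra.
move: h1 h2; rewrite !ltr_int; lia.
Qed.

Lemma same_bits_floor J (u v : R) : Num.floor u = Num.floor v ->
  (forall j, (j < J)%N -> bit j u = bit j v) ->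
  Num.floor (2 ^+ J * u) = Num.floor (2 ^+ J * v).
Proof.
move=> uv; elim: J => [|J IH] H; first by rewrite expr0 !mul1r.
have := H _ (ltnSn J); rewrite /bit IH; first by move/addIr.
by move=> j jJ; apply: H; apply: ltnW.
Qed.

Lemma same_bits_dist J (u v : R) : Num.floor u = Num.floor v ->
  (forall j, (j < J)%N -> bit j u = bit j v) -> `|u - v| <= 2^-1 ^+ J.
Proof.
move=> uv /(same_bits_floor _ _ _ uv) H.
have p0 : 0 < 2 ^+ J :> R by rewrite exprn_gt0.
rewrite exprVn -(ler_pM2l p0) mulfV ?gt_eqF // -[2 ^+ J in leLHS]gtr0_norm // -normrM mulrBr.
have := floor_itv (2 ^+ J * u); have := floor_itv (2 ^+ J * v).
rewrite H intrD => /andP[h1 h2] /andP[h3 h4].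
by rewrite ler_norml; apply/andP; split; lra.
Qed.

Variable l : R.
Hypothesis l0 : 0 < l.
Hypothesis l1 : 2 * l < 1.

Let l1' : l < 1.
Proof. by move: l0 l1 => h0 h1; lra. Qed.

Definition digit_value (d : nat -> int) : R := limn (series (fun k => l ^+ k * (d k)%:~R)).

Definition binary (d : nat -> int) := forall k, d k = 0 \/ d k = 1.

Let binary_itv d k : binary d -> 0 <= (d k)%:~R :> R /\ (d k)%:~R <= 1 :> R.
Proof. by move=> /(_ k) [] ->; rewrite ?ler01 ?lexx. Qed.

Let geo_le k n : \sum_(k <= i < n) l ^+ i <= l ^+ k / (1 - l).
Proof.
have [nk|/ltnW/subnKC <-] := leqP n k.
  by rewrite big_geq // divr_ge0 ?exprn_ge0 ?ltW // subr_gt0.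
rewrite geometric_partial_tail; apply: geometric_le_lim => //.
  by rewrite exprn_ge0 // ltW.
by rewrite gtr0_norm.
Qed.

Let digit_cvg d : binary d -> cvgn (series (fun k => l ^+ k * (d k)%:~R : R)).
Proof.
move=> bd; apply: (@series_le_cvg _ _ (geometric 1 l)).
- by move=> k; have [d0 _] := binary_itv d k bd; rewrite mulr_ge0 // exprn_ge0 // ltW.
- by move=> k; rewrite geometric_ge0 // ltW.
- move=> k; have [_ d1] := binary_itv d k bd.
  by rewrite /geometric /= mul1r ler_piMr // exprn_ge0 // ltW.
- by apply: is_cvg_geometric_series; rewrite gtr0_norm.
Qed.

Lemma digit_value_itv d : binary d -> 0 <= digit_value d <= (1 - l)^-1.
Proof.
move=> bd; apply/andP; split.
  apply: (@cvgn_ge _ _ _ _ 0 (digit_cvg d bd)) => n _; apply: sumr_ge0 => k _.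
  by have [d0 _] := binary_itv d k bd; rewrite mulr_ge0 // exprn_ge0 // ltW.
apply: (@cvgn_le _ _ _ _ 0 (digit_cvg d bd)) => n _.
rewrite -[leRHS]mul1r -(expr0 l); apply: le_trans (geo_le 0 n).
apply: ler_sum => k _; have [_ d1] := binary_itv d k bd.
by rewrite ler_piMr // exprn_ge0 // ltW.
Qed.

(** The first differing digit contributes [l^k], and all later ones can undo at most
    [l^(k+1) / (1 - l)]. The balance is positive exactly because [2 * l < 1]. *)
Lemma digit_value_sep d e k : binary d -> binary e ->
  (forall j, (j < k)%N -> d j = e j) -> d k = 0 -> e k = 1 ->
  l ^+ k * (1 - 2 * l) <= (1 - l) * (digit_value e - digit_value d).
Proof.
move=> bd be de dk ek; rewrite -ler_pdivrMl ?subr_gt0 //.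
apply: (@cvgn_ge _ _ _ _ k.+1 (cvgB (digit_cvg e be) (digit_cvg d bd))) => n kn.
rewrite /series /= -sumrB (big_cat_nat (n := k)) //=; last exact: ltnW.
rewrite big1_seq ?add0r; last first.
  by move=> i; rewrite mem_index_iota /= => ik; rewrite de // subrr.
rewrite big_ltn // dk ek mulr1 mulr0 subr0.
apply: (@le_trans _ _ (l ^+ k - l ^+ k.+1 / (1 - l))).
  have l1n0 : 1 - l != 0 by rewrite subr_eq0 gt_eqF.
  suff -> : (1 - l)^-1 * (l ^+ k * (1 - 2 * l)) = l ^+ k - l ^+ k.+1 / (1 - l) by [].
  by rewrite exprS; field; rewrite l1n0.
rewrite lerD2l lerNl -sumrN; apply: le_trans (geo_le k.+1 n).
apply: ler_sum => i _; have [d0 d1] := binary_itv d i bd.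
have [e0 e1] := binary_itv e i be.
rewrite -mulrBr -mulrN ler_piMr ?exprn_ge0 ?(ltW l0) //.
by rewrite opprB lerBlDr (le_trans d1) // lerDl.
Qed.

End BinaryDigits.

(** With digit weight [l = 2^(-m be) < 1/2], agreement of the first [m k] bits gives
    [|u - v|^be <= l^k], and the next differing digit separates the images by a multiple of [l^k].
    The bits see only fractional parts, whence the condition on the floors. *)
Lemma cube_spread {R : realType} (m' : nat) (be : R) : 1 < m'.+1%:R * be ->
  exists2 c : R, 0 < c & exists q : R -> 'rV[R]_m'.+1,
    (forall u, unit_cube (q u)) /\
    (forall u v, Num.floor u = Num.floor v ->
      c * `|u - v| `^ be <= lnorm (q u - q v)).
Proof.
set m := m'.+1 => mbe; pose l : R := 2^-1 `^ (m%:R * be).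
have be0 : 0 < be by rewrite -(pmulr_rgt0 _ (ltr0Sn R m')) (lt_trans ltr01).
have l0 : 0 < l by rewrite powR_gt0.
have l1 : 2 * l < 1.
  rewrite -ltr_pdivlMl // mulr1.
  have -> : l = 2^-1 `^ (m%:R * be - 1) * 2^-1.
    rewrite -{2}[2^-1]powRr1 // -powRD ?subrK //.
    by apply/implyP => _; rewrite invr_eq0 pnatr_eq0.
  by rewrite gtr_pMl // half_powR_lt1 // subr_gt0.
pose dig (u : R) (i : 'I_m) (k : nat) := bit (m * k + i) u.
have bdig u i : binary (dig u i) by move=> k; apply: bit01.
pose q (u : R) : 'rV[R]_m := \row_i ((1 - l) * digit_value l (dig u i)).
exists (1 - 2 * l); first lra.
exists q; split=> [u i|u v uv].
  have /andP[h1 h2] := digit_value_itv l l0 l1 _ (bdig u i).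
  have l1p : 0 < 1 - l by lra.
  rewrite mxE mulr_ge0 //=; last exact: ltW.
  by rewrite -ler_pdivlMl // mulr1.
have [->|ne] := eqVneq u v.
  by rewrite subrr normr0 powR0 ?gt_eqF // mulr0 lnorm_ge0.
have sep : exists j, bit j u != bit j v.
  have d0 : 0 < `|u - v| by rewrite normr_gt0 subr_eq0.
  have [J hJ] := half_pow_lt 1 _ d0; rewrite mul1r in hJ.
  apply: contrapT => /forallNP H; move: hJ; rewrite ltNge => /negP; apply.
  by apply: same_bits_dist => // j _; apply/eqP/negPn/negP; apply: H.
case: (ex_minnP sep) => J nJ Jmin.
have sameJ j : (j < J)%N -> bit j u = bit j v.
  by move=> jJ; apply/eqP/negPn/negP => /Jmin; rewrite leqNgt jJ.
(* The first differing bit [J] is the digit number [k] of coordinate [i]. *)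
pose i : 'I_m := inord (J %% m); pose k := (J %/ m)%N.
have JE : J = (m * k + i)%N by rewrite /i /k inordK ?ltn_mod // mulnC -divn_eq.
have uvk : `|u - v| `^ be <= l ^+ k.
  have -> : l ^+ k = (2^-1 ^+ (m * k)) `^ be.
    by rewrite exprM powR_exprn ?exprn_ge0 // /l powRrM powR_mulrn.
  apply: ler_powR_base => //; first exact: ltW.
  apply: same_bits_dist => // j jmk; apply: sameJ; rewrite JE.
  by apply: leq_trans jmk _; rewrite leq_addr.
apply: (@le_trans _ _ ((1 - 2 * l) * l ^+ k)); first by rewrite ler_wpM2l //; lra.
apply: le_trans (coord_le_lnorm _ i); rewrite !mxE -mulrBr.
have samed j : (j < k)%N -> dig u i j = dig v i j.
  by move=> jk; apply: sameJ; rewrite JE ltn_add2r ltn_pmul2l.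
have : dig u i k != dig v i k by rewrite /dig -JE.
rewrite mulrC; case: (bdig u i k); case: (bdig v i k) => dv du; rewrite dv du // => _.
  apply: le_trans (digit_value_sep l l0 l1 _ _ k (bdig u i) (bdig v i) samed du dv) _.
  by apply: le_trans (ler_norm _) _; rewrite -normrN -mulrN opprB.
have samed' j : (j < k)%N -> dig v i j = dig u i j by move=> /samed.
apply: le_trans (digit_value_sep l l0 l1 _ _ k (bdig v i) (bdig u i) samed' dv du) _.
exact: ler_norm.
Qed.

Lemma holder_piece {R : realType} {m' n' : nat} {T : Type}
    (X : T -> 'rV[R]_n'.+1) (a0 : T) (K t s : R) :
  0 <= t < s -> m'.+1%:R <= s ->
  (forall a b, close K (X a) (X b)) -> packing t X ->
  exists2 G, holder_cube m'.+1 (m'.+1%:R / s) G & forall a, G (X a).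
Proof.
move=> /andP[t0 ts] ms XK packX; set m := m'.+1.
have m0 : 0 < m%:R :> R by rewrite ltr0n.
have s0 : 0 < s by exact: le_lt_trans ts.
(* The midpoint leaves room on both sides: [t < s1] for the embedding in the line, and [s / s1 > 1]
   for spreading over [m] coordinates. *)
pose s1 := (t + s) / 2.
have ts1 : 0 <= t < s1 by rewrite t0 /s1; lra.
have s10 : 0 < s1 by rewrite /s1; lra.
have s1s : s1 < s by rewrite /s1; lra.
have [u [S [c [c0 uS uX]]]] := dyadic_embedding X K t s1 ts1 XK packX.
have S0 : 0 <= S by apply: le_trans (uS a0 a0).
(* The added 1 puts the rescaled values into [[0, 1)], so that all their floors vanish. *)
pose S1 := 2 * S + 1; have S10 : 0 < S1 by rewrite /S1; lra.
pose v a := (u a - u a0 + S) / S1.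
have v01 a : 0 <= v a < 1.
  have := uS a a0; rewrite ler_norml => /andP[h1 h2].
  rewrite /v divr_ge0 ?(ltW S10) //=; last lra.
  by rewrite ltr_pdivrMr // mul1r /S1; lra.
have vfl a b : Num.floor (v a) = Num.floor (v b).
  by rewrite !(@floor_def _ _ 0) // add0r.
have uv a b : `|u a - u b| = S1 * `|v a - v b|.
  rewrite -[S1 in RHS](gtr0_norm S10) -normrM; congr (`|_|).
  by rewrite /v; field; rewrite gt_eqF.
(* Then [m * be = s / s1] exceeds 1, and composing the exponents [1 / be] and [1 / s1] gives the
   required [m / s]. *)
pose be := s / (s1 * m%:R).
have mbe : 1 < m%:R * be.
  have -> : m%:R * be = s / s1 by rewrite /be; field; rewrite !gt_eqF.
  by rewrite ltr_pdivlMr // mul1r.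
have be0 : 0 < be by rewrite divr_gt0 // mulr_gt0.
have [d d0 [q [qcube qsep]]] := cube_spread m' be mbe.
pose C := (c * S1) `^ s1^-1 * (d^-1) `^ (be^-1 * s1^-1).
apply: (@holder_cube_cover _ _ _ _ X (fun a => q (v a)) (m%:R / s) C a0).
- by rewrite divr_gt0 //= ler_pdivrMr // mul1r.
- by rewrite mulr_ge0 ?powR_ge0.
- by move=> a; apply: qcube.
move=> a b i; set N := lnorm _.
have N0 : 0 <= N by apply: lnorm_ge0.
have vN : `|v a - v b| <= (d^-1 * N) `^ be^-1.
  rewrite -[leLHS]powRr1 // -[X in _ `^ X](@mulfV _ be) ?gt_eqF // powRrM.
  apply: ler_powR_base; rewrite ?invr_ge0 ?powR_ge0 ?(ltW be0) //.
  by rewrite ler_pdivlMl // qsep.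
rewrite -[leLHS]powRr1 // -[X in _ `^ X](@mulfV _ s1) ?gt_eqF // powRrM.
apply: (@le_trans _ _ ((c * S1 * (d^-1 * N) `^ be^-1) `^ s1^-1)).
  apply: ler_powR_base; rewrite ?invr_ge0 ?powR_ge0 ?(ltW s10) //.
  apply: le_trans (uX a b i) _; rewrite uv mulrA ler_wpM2l //.
  by rewrite mulr_ge0 // ltW.
rewrite powRM ?powR_ge0 ?mulr_ge0 ?(ltW S10) // /C -mulrA ler_wpM2l ?powR_ge0 //.
rewrite -powRrM powRM ?invr_ge0 ?(ltW d0) // ler_wpM2l ?powR_ge0 //.
suff -> : be^-1 / s1 = m%:R / s by [].
by rewrite /be; field; rewrite !gt_eqF.
Qed.

(** * Bi-Lipschitz arcs *)

Section Gaps.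
Context {R : realType} {n' : nat} {T : Type}.
Let n := n'.+1.
Variables (X : T -> 'rV[R]_n) (g : nat -> R).
Hypothesis g0 : forall k, 0 < g k.

(** The current class of [a] is cut at an open window of length [g] that it does not meet.
    Coordinates and levels are run through as in the dyadic order. *)
Definition gap_step (j : nat) (lt : rel T) : rel T := fun a b =>
  `[< exists z, [/\ X a 0 (inord (j %% n)) <= z,
       z + g (j %/ n) <= X b 0 (inord (j %% n)) &
       forall c, incomparable lt a c ->
         ~ (z < X c 0 (inord (j %% n)) < z + g (j %/ n))] >].

(** A positive window length fixes the direction of the cut. A third member of the class lies on one
    side of the window, and the same window then separates it from [a] or from [b]. *)
Lemma gap_stepP j lt : weak_order lt -> weak_order_on_classes lt (gap_step j lt).
Proof.
move=> wlt; rewrite /gap_step; set i := inord _; set e := g _.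
have e0 : 0 < e by apply: g0.
split=> [a b _ /asboolP [z [az zb _]]|a b c ab ac /asboolP [z [az zb Hz]]].
  by apply/asboolP => -[z' [bz' z'a _]]; lra.
have := Hz _ ac; have [cz _|zc /= /negP] := leP (X c 0 i) z.
  apply/orP; right; apply/asboolP; exists z; split=> // c' cc'; apply: Hz.
  exact: incomparable_trans cc'.
rewrite -leNgt => zec.
by apply/orP; left; apply/asboolP; exists z.
Qed.

Definition gap_lt (k : nat) : rel T := lexi gap_step (k * n).

Lemma weak_order_gap_lt k : weak_order (gap_lt k).
Proof. by apply: weak_order_lexi => j lt; apply: gap_stepP. Qed.

Lemma gap_lt_mono k k' a b : (k <= k')%N -> gap_lt k a b -> gap_lt k' a b.
Proof. by move=> kk'; apply: lexi_mono; rewrite leq_mul2r kk' orbT. Qed.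

Lemma gap_lt_split k a b : gap_lt k a b -> exists k' i, [/\ (k' < k)%N,
  incomparable (gap_lt k') a b & X a 0 i + g k' <= X b 0 i].
Proof.
move=> ab; have [j jk /andP[ij /asboolP [z [az zb _]]]] := lexi_split _ _ _ _ ab.
exists (j %/ n)%N, (inord (j %% n)); split; first by rewrite ltn_divLR.
  by apply: lexi_incomparable_mono ij; apply: leq_divM.
lra.
Qed.

Section Diameter.
Variables (K : R) (N : nat).
Hypothesis N0 : (0 < N)%N.
Hypothesis XK : forall a b, close K (X a) (X b).
Hypothesis gE : forall k, g k = K * 2^-1 ^+ k / (4 * N%:R).
Hypothesis crowded : forall k (s : seq T),
  pairwise (relpre X (apart (g k))) s ->
  pairwise (relpre X (close (K * 2^-1 ^+ k))) s -> (size s < N)%N.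

(* If no interval of length [g k] between the two values is free of the class, picking one
   class member in every second interval yields [N] points contradicting [crowded]. *)
Lemma gap_close k a b : incomparable (gap_lt k) a b ->
  close (K * 2^-1 ^+ k) (X a) (X b).
Proof.
elim: k a b => [a b _|k IH a b ab]; first by rewrite expr0 mulr1.
apply/forallP => i.
pose j := (k * n + i)%N.
have jk : (j < k.+1 * n)%N by rewrite /j mulSn addnC ltn_add2r.
have dE : (j %/ n = k)%N by rewrite divnMDl // divn_small // addn0.
have mE : inord (j %% n) = i.
  by apply: val_inj; rewrite /= modnMDl modn_small // inordK.
have iab : incomparable (lexi gap_step j) a b.
  by apply: lexi_incomparable_mono ab; apply: ltnW.
have N0' : 0 < N%:R :> R by rewrite ltr0n.
wlog le_ab : a b ab iab / X a 0 i <= X b 0 i.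
  move=> H; have [|/ltW] := leP (X a 0 i) (X b 0 i); first exact: H.
  by rewrite distrC; apply: H; rewrite incomparable_sym.
rewrite ler0_norm ?subr_le0 // opprB leNgt; apply/negP => far.
(* The [N] windows of period [2 * g k] span half of the stage-[k] bound, so all of them fit between
   [a] and [b] if these are farther apart than claimed. *)
have NgE : N%:R * (2 * g k) = K * 2^-1 ^+ k.+1.
  by rewrite gE exprS; field; rewrite gt_eqF.
have pick l : (l < N)%N -> exists c, incomparable (lexi gap_step j) a c /\
    (X a 0 i + l%:R * (2 * g k) < X c 0 i < X a 0 i + l%:R * (2 * g k) + g k).
  move=> lN; apply: contrapT => H.
  have := lexi_incomparable_step _ _ _ _ _ jk ab.
  rewrite /gap_step dE mE => /asboolP Hn; apply: Hn.
  have gk := g0 k.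
  exists (X a 0 i + l%:R * (2 * g k)); split.
  - by rewrite lerDl mulr_ge0 // mulr_ge0 // ltW.
  - have : l.+1%:R * (2 * g k) <= N%:R * (2 * g k).
      by rewrite ler_wpM2r ?ler_nat // mulr_ge0 // ltW.
    rewrite NgE -natr1; lra.
  - by move=> c ac Hc; apply: H; exists c.
have [c Hc] : exists c : nat -> T, forall l, (l < N)%N ->
    incomparable (lexi gap_step j) a (c l) /\
    (X a 0 i + l%:R * (2 * g k) < X (c l) 0 i < X a 0 i + l%:R * (2 * g k) + g k).
  have : forall l, exists c, (l < N)%N -> incomparable (lexi gap_step j) a c /\
    (X a 0 i + l%:R * (2 * g k) < X c 0 i < X a 0 i + l%:R * (2 * g k) + g k).
    by move=> l; have [/pick [c ?]|] := boolP (l < N)%N; [exists c|exists a].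
  by move=> /choice [c Hc]; exists c.
suff : (size [seq c l | l <- iota 0 N] < N)%N by rewrite size_map size_iota ltnn.
apply: (crowded k).
  rewrite pairwise_map; apply: (@sub_in_pairwise _ [pred l | (l < N)%N] ltn).
  - move=> l l' lN l'N /= ll'; apply/existsP; exists i.
    have [_ /andP[h1 h2]] := Hc l lN; have [_ /andP[h3 h4]] := Hc l' l'N.
    have gk := g0 k.
    have : l.+1%:R * (2 * g k) <= l'%:R * (2 * g k).
      by rewrite ler_wpM2r ?ler_nat // mulr_ge0 // ltW.
    rewrite -natr1 ler_normr => ?; apply/orP; right; lra.
  - by apply/allP => l; rewrite mem_iota.
  - rewrite -sorted_pairwise; [exact: iota_ltn_sorted|exact: ltn_trans].
rewrite pairwise_map; apply: (@sub_in_pairwise _ [pred l | (l < N)%N] ltn).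
- move=> l l' lN l'N _ /=; apply: IH.
  have kj : (k * n <= j)%N by rewrite leq_addr.
  have [h1 _] := Hc l lN; have [h2 _] := Hc l' l'N.
  apply: lexi_incomparable_mono kj _.
  apply: (@incomparable_trans _ _ a) h2; first by apply: weak_order_lexi => ? ?; apply: gap_stepP.
  by rewrite incomparable_sym.
- by apply/allP => l; rewrite mem_iota.
- rewrite -sorted_pairwise; [exact: iota_ltn_sorted|exact: ltn_trans].
Qed.

End Diameter.

End Gaps.

(** It suffices that [N^(1-t)] exceeds [C 4^t]. This choice of [N] makes the packing bound smaller
    than the number of windows to be filled. *)
Lemma sublinear_power {R : realType} (C t K : R) : 0 <= C -> t < 1 ->
  exists N : nat, [/\ (0 < N)%N, K <= N%:R & C * (4 * N%:R) `^ t < N%:R].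
Proof.
move=> C0 t1; pose D := C * 4 `^ t + 1.
have D1 : 1 <= D by rewrite lerDr mulr_ge0 ?powR_ge0.
have t1' : 0 < 1 - t by rewrite subr_gt0.
pose M := Num.max (Num.max 1 K) (D `^ (1 - t)^-1).
have M1 : 1 <= M by rewrite !le_max lexx.
have MN : M < (Num.bound M)%:R by apply: archi_boundP; apply: le_trans M1.
exists (Num.bound M); move: MN; set N := Num.bound M => MN.
have N0 : 0 < N%:R :> R by apply: lt_trans MN; apply: lt_le_trans M1.
split; first by rewrite -(ltr0n R).
  by apply: ltW; apply: le_lt_trans MN; rewrite !le_max lexx orbT.
rewrite powRM ?(ltW N0) // mulrA.
have NE : N%:R = N%:R `^ (1 - t) * N%:R `^ t :> R.
  rewrite -powRD ?subrK ?powRr1 ?(ltW N0) //.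
  by apply/implyP => _; rewrite gt_eqF.
rewrite [ltRHS]NE ltr_pM2r ?powR_gt0 //; apply: (@lt_le_trans _ _ D); first by rewrite ltrDl.
have D0 : 0 <= D by apply: le_trans D1.
rewrite -[leLHS]powRr1 // -[X in _ `^ X](@mulVf _ (1 - t)) ?gt_eqF // powRrM.
apply: ler_powR_base; rewrite ?powR_ge0 ?(ltW t1') //.
by apply: ltW; apply: le_lt_trans MN; rewrite !le_max lexx orbT.
Qed.

(** The scale [e] is [2^-k] for the last stage [k] at which the two points share a cell. A cut in
    the last coordinate keeps its sign, which later gives monotonicity. *)
Lemma gap_embedding {R : realType} {n' : nat} {T : Type}
    (X : T -> 'rV[R]_n'.+1) (K t : R) :
  0 <= t < 1 -> 0 < K -> (forall a b, close K (X a) (X b)) -> packing t X ->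
  exists (u : T -> R) (D g : R), [/\ 0 < D, 0 < g,
    forall a b, `|u a - u b| <= D,
    forall a b, u a = u b -> X a = X b
    & forall a b, u a < u b -> X a <> X b -> exists e, [/\ 0 < e,
      close (K * e) (X a) (X b), e / 2 <= u b - u a, u b - u a <= D * e
      & (exists2 i, i != ord_max & g * e <= `|X a 0 i - X b 0 i|) \/
        g * e <= X b 0 ord_max - X a 0 ord_max]].
Proof.
move=> /andP[t0 t1] K0 XK [C C0 Cpack].
have [N [N0 KN CN]] := sublinear_power C t K C0 t1.
have N0' : 0 < N%:R :> R by rewrite ltr0n.
have N1 : 1 <= N%:R :> R by rewrite ler1n.
pose kappa := K / (4 * N%:R).
have kappa0 : 0 < kappa by rewrite divr_gt0 // mulr_gt0.
have kappa1 : kappa <= 1 by rewrite ler_pdivrMr ?mulr_gt0 // mul1r; lra.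
have kappaK : kappa <= K / 2.
  rewrite /kappa ler_wpM2l ?(ltW K0) // lef_pV2 ?posrE ?mulr_gt0 //; lra.
pose h k : R := 2^-1 ^+ k.
have h0 k : 0 < h k by rewrite exprn_gt0 // invr_gt0.
have h1 k : h k <= 1 by rewrite exprn_ile1 // invf_le1 // ler1n.
have hS k : h k = 2 * h k.+1 by rewrite /h exprS mulrA mulfV ?mul1r // pnatr_eq0.
pose g k := K * h k / (4 * N%:R).
have gE k : g k = kappa * h k by rewrite /g /kappa mulrAC.
have g0 k : 0 < g k by rewrite gE mulr_gt0.
have g_mono i j : (i <= j)%N -> g j <= g i.
  move=> ij; rewrite !gE ler_wpM2l ?(ltW kappa0) // /h.
  by apply: ler_wiXn2l; rewrite ?invr_ge0 // invf_le1 // ler1n.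
have g1 k : 0 < g k <= 1.
  by rewrite g0 gE mulr_ile1 ?(ltW kappa0) ?(ltW (h0 k)).
have crowded k (s : seq T) : pairwise (relpre X (apart (g k))) s ->
  pairwise (relpre X (close (K * 2^-1 ^+ k))) s -> (size s < N)%N.
  move=> sa sc; rewrite -(ltr_nat R); apply: le_lt_trans CN.
  (* The quotient of diameter and gap length is [4 * N] at every stage, so one [N] serves all of
     them. *)
  have -> : 4 * N%:R = K * h k / g k.
    by rewrite /g; field; rewrite !gt_eqF // h0.
  apply: Cpack => //; rewrite gE -/(h k) ler_wpM2r ?(ltW (h0 k)) //; lra.
pose L := gap_lt X g.
have wL k : weak_order (L k) by apply: weak_order_gap_lt.
have L0 a b : L 0%N a b = false by [].
have Lmono i j a b : (i <= j)%N -> L i a b -> L j a b by apply: gap_lt_mono.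
have L_close k a b : incomparable (L k) a b -> close (K * h k) (X a) (X b).
  exact: (gap_close X g g0 K N N0 XK (fun=> erefl) crowded k a b).
pose b : R := 2 `^ t; pose w : R := 2^-1.
pose B := 1 + C * (2 * N%:R) `^ t.
have b1 : 1 <= b by rewrite /b -[leLHS](powRr0 2) ler_powR // ler1n.
have w0 : 0 < w by rewrite invr_gt0.
(* Here [w * b = 2^(t-1)], which is below 1 because [t < 1]. *)
have wb1 : w * b < 1.
  by rewrite /w -[2^-1](@powRr1 R) ?invr_ge0 // half_powRM half_powR_lt1 // subr_gt0.
have CN0 : 0 <= C * (2 * N%:R) `^ t by rewrite mulr_ge0 ?powR_ge0.
have B1 : 1 <= B by rewrite lerDl.
have B0 : 0 <= B by apply: le_trans B1.
have chain j k (l : seq T) : (j <= k)%N -> pairwise (L k) l ->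
    pairwise (incomparable (L j)) l -> (size l)%:R <= B * b ^+ (k - j).
  move=> jk pl il.
  have bkj : 1 <= b ^+ (k - j) by rewrite exprn_ege1.
  have [/eqP|] := posnP k.
    case: k jk pl {bkj} => // /[!leqn0] /eqP -> pl _.
    rewrite expr0 mulr1; apply: le_trans B1.
    by case: l pl il => [|x [|y l]].
  case: k jk pl bkj => // k jk pl bkj _.
  have hkj : h k <= 2 * h j.
    by rewrite hS ler_wpM2l // /h; apply: ler_wiXn2l; rewrite ?invr_ge0 // invf_le1 // ler1n.
  (* Points of a stage-[k.+1] chain are [g k] apart; this quotient yields the constant [(2 N)^t] in
     [B]. *)
  have E : K * h j / g k = 2 * N%:R * 2 ^+ (k.+1 - j).
    have -> : h j = h k.+1 * 2 ^+ (k.+1 - j).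
      have -> : h k.+1 = 2^-1 ^+ (k.+1 - j) * h j by rewrite /h -exprD subnK.
      by rewrite mulrAC -exprMn mulVf ?pnatr_eq0 // expr1n mul1r.
    rewrite /g (hS k); move: (2 ^+ _) => z; field.
    by rewrite !gt_eqF // h0.
  apply: (@le_trans _ _ (C * (K * h j / g k) `^ t)).
    apply: Cpack => //.
    - rewrite gE; apply: (@le_trans _ _ (K / 2 * h k)).
        by rewrite ler_wpM2r // ltW.
      by rewrite -mulrA ler_wpM2l ?(ltW K0) // ler_pdivrMl.
    - apply: sub_pairwise pl => x y /= Lxy.
      have [k' [i [k'k _ xy]]] := gap_lt_split _ _ _ _ _ Lxy.
      apply/existsP; exists i; rewrite ler_normr; apply/orP; right.
      have := g_mono _ _ (k'k : (k' <= k)%N); lra.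
    - by apply: sub_pairwise il => x y; exact: L_close.
  rewrite E powRM ?mulr_ge0 ?exprn_ge0 ?(ltW N0') // powR_exprn // mulrA.
  by rewrite ler_wpM2r ?exprn_ge0 ?powR_ge0 // lerDr.
have [u [ul uu]] := @rank_embedding R T L w b B wL L0 Lmono w0 b1 wb1 B0 chain.
pose D := B / (1 - w * b).
have D0 : 0 < D by rewrite divr_gt0 ?subr_gt0 // (lt_le_trans _ B1).
have sep a c : X a <> X c -> exists k, incomparable (L k) a c /\ (L k.+1 a c \/ L k.+1 c a).
  move=> ne.
  have [i ni] : exists i, X a 0 i != X c 0 i.
    apply: contrapT => /forallNP H; apply: ne; apply/rowP => i.
    by apply/eqP/negPn/negP; apply: H.
  have d0 : 0 < `|X a 0 i - X c 0 i| by rewrite normr_gt0 subr_eq0.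
  have ex : exists k, ~~ incomparable (L k) a c.
    have [k hk] := half_pow_lt K _ d0; exists k; apply/negP => /L_close /forallP /(_ i).
    by rewrite leNgt hk.
  case: (ex_minnP ex) => -[|k]; first by rewrite /incomparable !L0.
  move=> nk kmin; exists k; split; first by apply/negPn/negP => /kmin; rewrite ltnn.
  by move: nk; rewrite negb_and !negbK => /orP.
have wk k : 0 < w ^+ k by rewrite exprn_gt0.
exists u, D, kappa; split=> //.
- by move=> a c; have := uu 0%N a c; rewrite expr0 mul1r; apply.
- move=> a c uac; apply: contrapT => /sep [k [_ [/ul|/ul]]]; have := wk k.+1; lra.
move=> a c uac /sep [k [iac [ac|ca]]]; last by have := ul _ _ _ ca; have := wk k.+1; lra.
exists (h k); split=> //.
- exact: L_close.
- have := ul _ _ _ ac; rewrite -[w ^+ k.+1]/(h k.+1) (hS k); lra.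
- have := uu _ _ _ iac; rewrite distrC => /(le_trans (ler_norm _)).
  by rewrite -mulrA mulrC.
have [k' [i [k'k _ xy]]] := gap_lt_split _ _ _ _ _ ac.
have := g_mono _ _ (k'k : (k' <= k)%N); rewrite gE => gkk.
have [ie|ine] := eqVneq i ord_max; [right|left].
  by move: xy; rewrite ie; lra.
by exists i => //; rewrite ler_normr; apply/orP; right; lra.
Qed.

(** * Extension of a parametrised set to a bi-Lipschitz line *)

Section BilipschitzArc.
Context {R : realType} {n' : nat} {T : Type}.
Variables (X : T -> 'rV[R]_n'.+1) (u : T -> R) (a0 : T) (K c0 c1 L : R).
Hypothesis K0 : 0 < K.
Hypothesis c00 : 0 < c0.
Hypothesis c01 : c0 <= c1.
Hypothesis L0 : 0 <= L.

(** Slope [c1] on positive and [c0] on negative arguments: bounding a difference by [psi] is an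
    upper Lipschitz bound and a lower bound on growth at once. A maximum of linear functions is
    subadditive, as [mcshane] requires. *)
Let psi (r : R) := Num.max (c1 * r) (c0 * r).
Let side (z : 'rV[R]_n'.+1) : R := \sum_(i | i != ord_max) `|z 0 i|.

Hypothesis X_lip : forall a b i, `|X a 0 i - X b 0 i| <= K * `|u a - u b|.
Hypothesis X_mono : forall a b,
  X a 0 ord_max - X b 0 ord_max <= psi (u a - u b) + L * side (X a - X b).

Let psi0 : psi 0 = 0. Proof. by rewrite /psi !mulr0 maxxx. Qed.

Let psiD r s : psi (r + s) <= psi r + psi s.
Proof.
rewrite /psi ge_max; apply/andP; split; rewrite mulrDr; apply: lerD;
  by rewrite le_max lexx ?orbT.
Qed.

Let psi_pos r : 0 <= r -> psi r = c1 * r.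
Proof. by move=> r0; apply/max_idPl; rewrite ler_wpM2r. Qed.

Let psi_neg r : 0 <= r -> psi (- r) = - (c0 * r).
Proof. by move=> r0; rewrite /psi !mulrN; apply/max_idPr; rewrite lerN2 ler_wpM2r. Qed.

Let side0 : side 0 = 0.
Proof. by rewrite /side big1 // => i _; rewrite mxE normr0. Qed.

Let sideD x y : side (x + y) <= side x + side y.
Proof. by rewrite /side -big_split /=; apply: ler_sum => i _; rewrite !mxE ler_normD. Qed.

Let side_ge0 x : 0 <= side x. Proof. by apply: sumr_ge0. Qed.

Let side_le_lnorm x : side x <= lnorm x.
Proof.
rewrite /lnorm (bigID (fun i => i != ord_max)) /= lerDl; exact: sumr_ge0.
Qed.

(* The graph of [h] carries the sideways coordinates and [G] the last one; the
   strict monotonicity of [G] in the parameter, built into [psi], keeps the arc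
   from turning back. *)
Lemma bilipschitz_line : exists (F : R -> 'rV[R]_n'.+1) (M e : R),
  [/\ 0 <= M, 0 < e, forall a, F (u a) = X a,
    forall v w, enorm (F v - F w) <= M * `|v - w|
    & forall v w, e * `|v - w| <= enorm (F v - F w)].
Proof.
have [h hP] : exists h : 'I_n'.+1 -> R -> R,
    forall i, (forall v w, h i v - h i w <= K * `|v - w|) /\
      (forall a, h i (u a) = X a 0 i).
  have : forall i, exists hi : R -> R, (forall v w, hi v - hi w <= K * `|v - w|) /\
      (forall a, hi (u a) = X a 0 i).
    move=> i; apply: (mcshane (fun v w => K * `|v - w|) u (fun a => X a 0 i) a0).
    - by move=> z; rewrite subrr normr0 mulr0.
    - by move=> x y z; rewrite -mulrDr ler_wpM2l ?(ltW K0) // ler_distD.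
    - move=> a b; exact: le_trans (ler_norm _) (X_lip a b i).
  by move=> /choice [h hP]; exists h.
have h_lip i v w : `|h i v - h i w| <= K * `|v - w|.
  have [H _] := hP i; rewrite ler_norml; apply/andP; split; last exact: H.
  by rewrite lerNl opprB distrC; exact: H.
pose H v : 'rV[R]_n'.+1 := \row_i h i v.
have HX a : H (u a) = X a by apply/rowP => i; rewrite mxE; case: (hP i).
pose rho (p q : R * 'rV[R]_n'.+1) := psi (p.1 - q.1) + L * side (p.2 - q.2).
have [G [G_rho GX]] : exists G : R * 'rV[R]_n'.+1 -> R,
    (forall z w, G z - G w <= rho z w) /\
    (forall a, G (u a, X a) = X a 0 ord_max).
  apply: (mcshane rho (fun a => (u a, X a)) (fun a => X a 0 ord_max) a0).
  - by move=> z; rewrite /rho !subrr psi0 side0 mulr0 addr0.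
  - move=> x y z; rewrite /rho.
    have -> : x.1 - z.1 = (x.1 - y.1) + (y.1 - z.1) by rewrite addrA subrK.
    have -> : x.2 - z.2 = (x.2 - y.2) + (y.2 - z.2) by rewrite addrA subrK.
    rewrite [leRHS]addrACA -mulrDr; apply: lerD => //.
    by rewrite ler_wpM2l.
  - by move=> a b; exact: X_mono.
pose F v : 'rV[R]_n'.+1 :=
  \row_i (if i == ord_max then G (v, H v) else h i v).
have Fside v w : side (F v - F w) = side (H v - H w).
  by apply: eq_bigr => i /negbTE ie; rewrite !mxE ie.
have Fmax v w : F v 0 ord_max - F w 0 ord_max <= psi (v - w) + L * side (F v - F w).
  by rewrite !mxE !eqxx Fside; exact: G_rho.
pose N : R := n'.+1%:R.
have N0 : 0 <= N by [].
have sideH v w : side (F v - F w) <= N * (K * `|v - w|).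
  rewrite Fside; apply: le_trans (side_le_lnorm _) _; apply: lnorm_le_coord => i.
  by rewrite !mxE.
have c10 : 0 <= c1 by apply: le_trans c01; exact: ltW.
pose M1 := Num.max K (c1 + L * (N * K)).
have M1_ge0 : 0 <= M1 by rewrite le_max (ltW K0).
have psi_le r : psi r <= c1 * `|r|.
  rewrite /psi ge_max; apply/andP; split; first by rewrite ler_wpM2l // ler_norm.
  apply: (@le_trans _ _ (c0 * `|r|)); first by rewrite ler_wpM2l ?ler_norm // ltW.
  by rewrite ler_wpM2r.
have Flast v w : F v 0 ord_max - F w 0 ord_max <= (c1 + L * (N * K)) * `|v - w|.
  apply: le_trans (Fmax v w) _; rewrite mulrDl; apply: lerD => //.
  by rewrite -!mulrA ler_wpM2l.
pose e := c0 / (1 + L * N).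
have LN0 : 0 < 1 + L * N by rewrite ltr_wpDr // mulr_ge0.
exists F, (N * M1), e; split.
- exact: mulr_ge0.
- exact: divr_gt0.
- move=> a; apply/rowP => i; rewrite mxE; have [->|_] := eqVneq i ord_max.
    by rewrite HX GX.
  by case: (hP i).
- move=> v w; apply: le_trans (enorm_le_lnorm _) _; rewrite -mulrA.
  apply: lnorm_le_coord => i; have [->|/negbTE ie] := eqVneq i ord_max; last first.
    rewrite !mxE ie; apply: le_trans (h_lip i v w) _.
    by rewrite ler_wpM2r // le_max lexx.
  have -> : (F v - F w) 0 ord_max = F v 0 ord_max - F w 0 ord_max by rewrite !mxE.
  apply: (@le_trans _ _ ((c1 + L * (N * K)) * `|v - w|)).
    rewrite ler_norml; apply/andP; split; last exact: Flast.
    by rewrite lerNl opprB distrC; exact: Flast.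
  by rewrite ler_wpM2r // le_max lexx orbT.
(* For [v <= w], [psi (v - w) = - c0 (w - v)]: either the last coordinate grows or the others move,
   and both are controlled by the norm, with total factor [1 + L * N]. *)
suff half v w : v <= w -> e * (w - v) <= enorm (F v - F w).
  move=> v w; have [vw|/ltW wv] := leP v w.
    by rewrite ler0_norm ?subr_le0 // opprB half.
  rewrite ger0_norm ?subr_ge0 //; apply: le_trans (half _ _ wv) _.
  by rewrite enorm_distC.
move=> vw; rewrite /e mulrAC ler_pdivrMr //.
have := Fmax v w; rewrite -[v - w]opprB; rewrite psi_neg ?subr_ge0 // => Fm.
have s1 : side (F v - F w) <= N * enorm (F v - F w).
  exact: le_trans (side_le_lnorm _) (lnorm_le_enorm _).
have s2 := ler_wpM2l L0 s1.
have := coord_le_enorm (F v - F w) ord_max.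
have -> : (F v - F w) 0 ord_max = F v 0 ord_max - F w 0 ord_max by rewrite !mxE.
rewrite ler_norml => /andP[h1 h2].
have : c0 * (w - v) <= enorm (F v - F w) + L * (N * enorm (F v - F w)) by lra.
by move=> /le_trans; apply; rewrite [leRHS]mulrDr mulr1 [_ * (L * N)]mulrC mulrA.
Qed.

End BilipschitzArc.

Lemma bilipschitz_piece {R : realType} {n' : nat} {T : Type}
    (X : T -> 'rV[R]_n'.+1) (a0 : T) (K t : R) :
  injective X -> 0 <= t < 1 -> 0 < K ->
  (forall a b, close K (X a) (X b)) -> packing t X ->
  exists2 f : R -> 'rV[R]_n'.+1, bilipschitz_embedding f &
    forall a, (f @` `[0, 1]) (X a).
Proof.
move=> Xinj t01 K0 XK packX.
have [u [D [g [D0 g0 uD uinj sep]]]] := gap_embedding X K t t01 K0 XK packX.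
(* A gain of [g * e] in the last coordinate must pay for [c0 (u b - u a) <= c0 D e]; the bound
   [2 * K] keeps [c0] below the upper slope. *)
pose c0 := Num.min (g / D) (2 * K).
have c00 : 0 < c0 by rewrite lt_min divr_gt0 // mulr_gt0.
have c0K : c0 <= 2 * K by rewrite ge_min lexx orbT.
have c0g : c0 * D <= g by rewrite -ler_pdivlMr // ge_min lexx.
(* When another coordinate moves by [g * e], the term with [L] pays both for a drop [K e] of the
   last coordinate and for [c0 D e]. *)
pose L := (K + c0 * D) / g.
have L0 : 0 <= L by rewrite divr_ge0 // ?(ltW g0) // addr_ge0 // ?ltW // mulr_gt0.
have X_eq a b : u a = u b -> X a = X b by apply: uinj.
have X_lip_lt a b i : u a < u b -> `|X a 0 i - X b 0 i| <= 2 * K * (u b - u a).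
  move=> ab; have [Xab|/eqP Xab] := eqVneq (X a) (X b).
    by rewrite Xab subrr normr0 !mulr_ge0 // ?(ltW K0) // subr_ge0 ltW.
  have [e [e0 /forallP/(_ i) cl eu _ _]] := sep _ _ ab Xab.
  apply: le_trans cl _; rewrite -mulrA mulrCA ler_wpM2l ?(ltW K0) //; lra.
have X_lip a b i : `|X a 0 i - X b 0 i| <= 2 * K * `|u a - u b|.
  have [ab|ba|/X_eq ->] := ltgtP (u a) (u b).
  - by rewrite [`|u a - u b|]ltr0_norm ?subr_lt0 // opprB X_lip_lt.
  - by rewrite [`|u a - u b|]gtr0_norm ?subr_gt0 // distrC X_lip_lt.
  - by rewrite subrr normr0 mulr_ge0 // mulr_ge0 // ltW.
have sidep (z : 'rV[R]_n'.+1) : 0 <= \sum_(i | i != ord_max) `|z 0 i| by apply: sumr_ge0.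
have X_mono a b : X a 0 ord_max - X b 0 ord_max <=
    Num.max (2 * K * (u a - u b)) (c0 * (u a - u b)) +
    L * \sum_(i | i != ord_max) `|(X a - X b) 0 i|.
  set S := \sum_(i | _) _.
  have LS : 0 <= L * S by exact: mulr_ge0 L0 (sidep _).
  have [ab|ba|ab] := ltgtP (u a) (u b); last first.
  - by rewrite (X_eq _ _ ab) ab !subrr !mulr0 maxxx add0r.
  - have := X_lip_lt _ _ ord_max ba; rewrite distrC => /(le_trans (ler_norm _)) H.
    by apply: le_trans H _; rewrite -[leLHS]addr0 lerD // le_max lexx.
  have [Xab|/eqP Xab] := eqVneq (X a) (X b).
    by move: ab; rewrite (Xinj _ _ Xab) ltxx.
  have [e [e0 /forallP/(_ ord_max) cl _ uDe alt]] := sep _ _ ab Xab.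
  rewrite -lerBlDr; apply: le_trans (_ : c0 * (u a - u b) <= _); last by rewrite le_max lexx orbT.
  have cu : c0 * (u b - u a) <= c0 * D * e by rewrite -mulrA ler_wpM2l // ltW.
  case: alt => [[i ie gi]|gi].
    have iS : `|X a 0 i - X b 0 i| <= S.
      by rewrite /S (bigD1 i) //= !mxE lerDl sumr_ge0.
    have : L * (g * e) <= L * S by rewrite ler_wpM2l // (le_trans gi).
    have -> : L * (g * e) = (K + c0 * D) * e by rewrite /L mulrA divfK // gt_eqF.
    move: cl; rewrite ler_norml => /andP[h1 h2]; lra.
  have : c0 * D * e <= g * e by rewrite ler_wpM2r // ltW.
  lra.
have [F [M [e [M0 e0 FX Flip Fexp]]]] :=
  bilipschitz_line X u a0 (2 * K) c0 (2 * K) L (mulr_gt0 (ltr0Sn _ 1) K0) c00 c0K L0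
    X_lip X_mono.
(* The unit interval is mapped onto the interval of radius [D] about [u a0], which contains all
   values of [u]. *)
pose al := u a0 - D; pose S := 2 * D.
have S0 : 0 < S by rewrite mulr_gt0.
exists (fun r => F (al + S * r)); last first.
  move=> a; exists ((u a - al) / S); last by rewrite mulrC divfK ?gt_eqF // addrC subrK FX.
  rewrite /= in_itv /=; have := uD a a0; rewrite ler_norml => /andP[h1 h2].
  rewrite divr_ge0 ?(ltW S0) //=; last by rewrite /al; lra.
  by rewrite ler_pdivrMr // mul1r /al /S; lra.
pose Lb := Num.max 1 (Num.max (M * S) (e * S)^-1).
have Lb1 : 1 <= Lb by rewrite le_max lexx.
have dE x y : `|al + S * x - (al + S * y)| = S * `|x - y|.
  rewrite -[S in RHS](gtr0_norm S0) -normrM; congr (`|_|); ring.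
exists Lb; split=> // x y _ _; apply/andP; split.
  apply: le_trans (Fexp _ _); rewrite dE mulrA ler_wpM2r //.
  rewrite -[leRHS]invrK lef_pV2 ?posrE ?invr_gt0 ?mulr_gt0 //; last exact: lt_le_trans Lb1.
  by rewrite !le_max lexx !orbT.
apply: le_trans (Flip _ _) _; rewrite dE mulrA ler_wpM2r //.
by rewrite !le_max lexx orbT.
Qed.

(** * Hausdorff measure and densities *)

Section Hausdorff.
Context {R : realType} {n : nat}.
Implicit Types (A B U : set 'rV[R]_n) (t d e : R).

Lemma diam_power_ge0 t U : (0 <= diam_power t U)%E.
Proof. by rewrite /diam_power; case: ifP => // _; apply: poweR_ge0. Qed.

Lemma diam_power_set0 t : diam_power t (set0 : set 'rV[R]_n) = 0%E.
Proof. by rewrite /diam_power eqxx. Qed.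

Lemma ediam_set0 : ediam (set0 : set 'rV[R]_n) = -oo%E.
Proof.
rewrite /ediam (_ : [set _ | _ in _] = set0) ?ereal_sup0 //.
by apply/seteqP; split => // x [z [[]]].
Qed.

Lemma ediam_ge U x y : U x -> U y -> ((enorm (x - y))%:E <= ediam U)%E.
Proof. by move=> Ux Uy; apply: ereal_sup_ubound; exists (x, y). Qed.

Lemma ediam_le U (r : R) x : (forall y, U y -> close r y x) ->
  (ediam U <= (n%:R * (2 * r))%:E)%E.
Proof.
move=> Ur; apply: ge_ereal_sup => _ [[y z] [/= Uy Uz] <-]; rewrite lee_fin.
apply: le_trans (enorm_le_lnorm _) _; apply: lnorm_le_coord => i.
have /forallP/(_ i) h1 := Ur _ Uy; have /forallP/(_ i) h2 := Ur _ Uz.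
rewrite !mxE; apply: le_trans (ler_distD (x 0 i) _ _) _.
by rewrite [X in _ + X <= _]distrC; lra.
Qed.

Lemma diam_power_le U t (r : R) x : 0 <= t -> 0 <= r ->
  (forall y, U y -> close r y x) ->
  (diam_power t U <= ((n%:R * (2 * r)) `^ t)%:E)%E.
Proof.
move=> t0 r0 Ur; rewrite /diam_power; case: ifPn => [_|/set0P [y Uy]].
  by rewrite lee_fin powR_ge0.
rewrite -poweR_EFin; apply: gt0_ler_poweR => //.
- rewrite in_itv /= leey andbT; apply: le_trans (ediam_ge _ _ _ Uy Uy).
  by rewrite lee_fin enorm_ge0.
- by rewrite in_itv /= leey andbT lee_fin !mulr_ge0.
- exact: ediam_le Ur.
Qed.

Lemma premeasure_ge0 t d A : (0 <= hausdorff_premeasure t d A)%E.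
Proof.
apply: le_ereal_inf_tmp => _ [U _ <-]; apply: nneseries_ge0 => i _ _.
exact: diam_power_ge0.
Qed.

Lemma premeasure_subset t d A B : A `<=` B ->
  (hausdorff_premeasure t d A <= hausdorff_premeasure t d B)%E.
Proof.
move=> AB; apply: ereal_inf_le_tmp => _ [U [Ud BU] <-]; exists U => //; split=> //.
exact: subset_trans AB BU.
Qed.

Lemma premeasure_anti t d e A : d <= e ->
  (hausdorff_premeasure t e A <= hausdorff_premeasure t d A)%E.
Proof.
move=> de; apply: ereal_inf_le_tmp => _ [U [Ud AU] <-]; exists U => //; split=> // i.
by apply: le_trans (Ud i) _; rewrite lee_fin.
Qed.

Lemma premeasure_le_hausdorff t d A : 0 < d ->
  (hausdorff_premeasure t d A <= hausdorff t A)%E.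
Proof. by move=> d0; apply: ereal_sup_ubound; exists d. Qed.

Lemma hausdorff_ge0 t A : (0 <= hausdorff t A)%E.
Proof. exact: le_trans (premeasure_ge0 t 1 A) (premeasure_le_hausdorff _ _ _ ltr01). Qed.

Lemma hausdorff_subset t A B : A `<=` B -> (hausdorff t A <= hausdorff t B)%E.
Proof.
move=> AB; apply: ge_ereal_sup => _ [d d0 <-].
apply: le_trans (premeasure_le_hausdorff t d B d0); exact: premeasure_subset.
Qed.

(** Null sets are characterised through finite partial sums, so later arguments only have to bound
    finite sums. *)
Lemma hausdorff_eq0 t A :
  (forall d e, 0 < d -> 0 < e -> exists U : nat -> set 'rV[R]_n,
    [/\ forall i, (ediam (U i) <= d%:E)%E, A `<=` \bigcup_i U i &
      forall N, (\sum_(0 <= i < N) diam_power t (U i) <= e%:E)%E]) <->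
  hausdorff t A = 0%E.
Proof.
split=> [H|H d e d0 e0].
  apply/eqP; rewrite eq_le hausdorff_ge0 andbT; apply: ge_ereal_sup => _ [d /= d0 <-].
  apply/lee_addgt0Pr => e e0; rewrite add0e.
  have [U [Ud AU Us]] := H d e d0 e0.
  apply: (@le_trans _ _ (\sum_(i <oo) diam_power t (U i))%E).
    by apply: ereal_inf_lbound; exists U.
  apply: lime_le; first by apply: is_cvg_nneseries => i _ _; apply: diam_power_ge0.
  by apply: nearW => N; exact: Us.
have : (hausdorff_premeasure t d A < e%:E)%E.
  by apply: le_lt_trans (premeasure_le_hausdorff t d A d0) _; rewrite H lte_fin.
move=> /ereal_inf_lt [_ [U [Ud AU] <-] Ue]; exists U; split=> // N.
apply: le_trans (ltW Ue); apply: nneseries_lim_ge => i _ _; exact: diam_power_ge0.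
Qed.

Lemma hausdorff_set0 t : hausdorff t (set0 : set 'rV[R]_n) = 0%E.
Proof.
apply/hausdorff_eq0 => d e d0 e0; exists (fun=> set0); split=> //.
  by move=> i; rewrite ediam_set0 leNye.
by move=> N; rewrite big1 ?lee_fin ?ltW // => i _; apply: diam_power_set0.
Qed.

(** The two covers are interleaved over even and odd indices. *)
Lemma hausdorff_null_setU t A B : hausdorff t A = 0%E -> hausdorff t B = 0%E ->
  hausdorff t (A `|` B) = 0%E.
Proof.
move=> /hausdorff_eq0 HA /hausdorff_eq0 HB; apply/hausdorff_eq0 => d e d0 e0.
have e2 : 0 < e / 2 by rewrite divr_gt0.
have [U [Ud AU Us]] := HA d _ d0 e2; have [V [Vd BV Vs]] := HB d _ d0 e2.
pose W i := if odd i then V i./2 else U i./2.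
exists W; split.
- by move=> i; rewrite /W; case: ifP.
- move=> x [/AU [i _ Ui]|/BV [i _ Vi]].
    by exists i.*2 => //; rewrite /W odd_double doubleK.
  by exists i.*2.+1 => //; rewrite /W /= odd_double /= uphalf_double.
move=> N; have sum2 M : (\sum_(0 <= i < M.*2) diam_power t (W i) =
    \sum_(0 <= i < M) diam_power t (U i) + \sum_(0 <= i < M) diam_power t (V i))%E.
  elim: M => [|M IH]; first by rewrite !big_geq // adde0.
  rewrite doubleS !big_nat_recr //= IH /W /= odd_double /= doubleK uphalf_double.
  by rewrite -addeA addeACA.
apply: (@le_trans _ _ (\sum_(0 <= i < N.*2) diam_power t (W i))%E).
  have N2 : (N <= N.*2)%N by rewrite -addnn leq_addr.
  rewrite (big_cat_nat (leq0n N) N2) /=.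
  by rewrite leeDl // sume_ge0 // => i _; apply: diam_power_ge0.
rewrite sum2 (_ : e%:E = (e / 2)%:E + (e / 2)%:E)%E; first exact: leeD.
by rewrite -EFinD -splitr.
Qed.

(** A set of diameter at most [d < g] cannot meet both [A] and [B], so every cover of the union
    splits into two covers without common members. *)
Lemma premeasure_separated t d (g : R) A B : d < g ->
  (forall x y, A x -> B y -> g <= enorm (x - y)) ->
  (hausdorff_premeasure t d A + hausdorff_premeasure t d B <=
   hausdorff_premeasure t d (A `|` B))%E.
Proof.
move=> dg sep; apply: le_ereal_inf_tmp => _ [U [Ud ABU] <-].
pose V C i := if `[< U i `&` C !=set0 >] then U i else set0.
have Vd C i : (ediam (V C i) <= d%:E)%E.
  by rewrite /V; case: ifP => // _; rewrite ediam_set0 leNye.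
have CV C : C `<=` A `|` B -> C `<=` \bigcup_i V C i.
  move=> CAB x Cx; have [i _ Ux] := ABU _ (CAB _ Cx); exists i => //.
  by rewrite /V; case: ifP => // /asboolP; case; exists x.
apply: (@le_trans _ _ (\sum_(i <oo) diam_power t (V A i) +
    \sum_(i <oo) diam_power t (V B i))%E).
  apply: leeD; apply: ereal_inf_lbound.
    by exists (V A) => //; split; [exact: Vd | apply: CV => x; left].
  by exists (V B) => //; split; [exact: Vd | apply: CV => x; right].
rewrite -nneseriesD; [|by move=> i _ _; apply: diam_power_ge0..].
apply: lee_nneseries => [i _ _|i _].
  by apply: adde_ge0; apply: diam_power_ge0.
rewrite /V; case: asboolP => [[x [Ux Ax]]|_]; last first.
  rewrite diam_power_set0 add0e; case: ifP => // _.
  by rewrite diam_power_set0 diam_power_ge0.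
case: asboolP => [[y [Uy By]]|_]; last by rewrite diam_power_set0 adde0.
have := le_trans (ediam_ge _ _ _ Ux Uy) (Ud i); rewrite lee_fin.
by move=> h1; have h2 := sep _ _ Ax By; exfalso; lra.
Qed.

(** Superadditivity on separated sets is what turns disjoint balls into a count. The two suprema
    over scales are taken one after the other, with infinite values set aside. *)
Lemma hausdorff_separated t (g : R) A B : 0 < g ->
  (forall x y, A x -> B y -> g <= enorm (x - y)) ->
  (hausdorff t A + hausdorff t B <= hausdorff t (A `|` B))%E.
Proof.
move=> g0 sep.
have pre d e : 0 < d -> 0 < e ->
    (hausdorff_premeasure t d A + hausdorff_premeasure t e B <= hausdorff t (A `|` B))%E.
  move=> d0 e0; pose f := Num.min (Num.min d e) (g / 2).
  have f0 : 0 < f by rewrite !lt_min d0 e0 divr_gt0.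
  have fg : f < g by rewrite gt_min; apply/orP; right; lra.
  apply: le_trans (premeasure_le_hausdorff t f _ f0).
  apply: le_trans (premeasure_separated t f g A B fg sep).
  by apply: leeD; apply: premeasure_anti; rewrite !ge_min lexx ?orbT.
have [Boo|Bfin] := eqVneq (hausdorff t B) +oo%E.
  rewrite Boo; apply: (@le_trans _ _ +oo%E); first exact: leey.
  by rewrite -Boo; apply: hausdorff_subset => x; right.
have Bfn : hausdorff t B \is a fin_num.
  by rewrite ge0_fin_numE ?hausdorff_ge0 // ltey.
rewrite -leeBrDr //; apply: ge_ereal_sup => _ [d d0 <-]; rewrite leeBrDr //.
have [Xoo|Xfin] := eqVneq (hausdorff t (A `|` B)) +oo%E; first by rewrite Xoo leey.
have Afn : hausdorff_premeasure t d A \is a fin_num.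
  rewrite ge0_fin_numE ?premeasure_ge0 //.
  apply: le_lt_trans (premeasure_le_hausdorff t d A d0) _.
  apply: le_lt_trans (hausdorff_subset t A (A `|` B) _) _; first by move=> x; left.
  by rewrite ltey.
rewrite addeC -leeBrDr //; apply: ge_ereal_sup => _ [e e0 <-].
by rewrite leeBrDr // addeC; apply: pre.
Qed.

Lemma hausdorff_separated_sum t (g : R) (S : nat -> set 'rV[R]_n) (N : nat) : 0 < g ->
  (forall i j x y, (i < j < N)%N -> S i x -> S j y -> g <= enorm (x - y)) ->
  (\sum_(0 <= i < N) hausdorff t (S i) <= hausdorff t [set x | exists2 i, (i < N)%N & S i x])%E.
Proof.
move=> g0; elim: N => [|N IH] sep; first by rewrite big_geq // hausdorff_ge0.
rewrite big_nat_recr //=.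
apply: le_trans (_ : _ <= hausdorff t ([set x | exists2 i, (i < N)%N & S i x] `|` S N))%E _.
  apply: le_trans (hausdorff_separated t g _ _ g0 _).
    apply: leeD => //; apply: IH => i j x y /andP[ij jN]; apply: sep.
    by rewrite ij ltnW.
  by move=> x y [i iN Si] Sy; apply: (sep i N) => //; rewrite iN ltnSn.
apply: hausdorff_subset => x [[i iN Si]|Sx]; last by exists N.
by exists i => //; apply: ltnW.
Qed.

End Hausdorff.

(** * Vitali selection with sizes comparable up to a factor 2 *)

Section Greedy.
Context {R : realType} {T : eqType}.
Variables (V : set T) (r : T -> R) (M : R) (near_ : T -> T -> Prop).
Hypothesis r0 : forall x, V x -> 0 < r x.
Hypothesis rM : forall x, V x -> r x <= M.

Let candidate (s : seq T) : set T :=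
  [set x | V x /\ forall y, y \in s -> ~ near_ x y].

Let best (s : seq T) : set T :=
  [set x | candidate s x /\ forall y, candidate s y -> r y <= 2 * r x].

Let best_exists s : candidate s !=set0 -> best s !=set0.
Proof.
move=> [x0 cx0]; pose E := [set r x | x in candidate s].
have supE : has_sup E.
  split; first by exists (r x0), x0.
  by exists M => _ [x [Vx _] <-]; apply: rM.
have E0 : 0 < sup E.
  apply: (@lt_le_trans _ _ (r x0)); first by apply: r0; case: cx0.
  by apply: sup_upper_bound => //; exists x0.
have [_ [x cx <-] h] := sup_adherent (divr_gt0 E0 (ltr0Sn _ 1)) supE.
exists x; split=> // y cy; apply: (@le_trans _ _ (sup E)).
  by apply: sup_upper_bound => //; exists y.
lra.
Qed.

Let pick_best s : option T :=
  if pselect (best s !=set0) is left h then Some (projT1 (cid h)) else None.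

Fixpoint greedy (k : nat) : seq T :=
  if k is k'.+1 then
    if pick_best (greedy k') is Some x then x :: greedy k' else greedy k'
  else [::].

Let pick_bestP s x : pick_best s = Some x -> best s x.
Proof. by rewrite /pick_best; case: pselect => // h [<-]; case: (cid h). Qed.

Let pick_best_cand s x : candidate s x ->
  exists2 y, pick_best s = Some y & r x <= 2 * r y.
Proof.
move=> cx; rewrite /pick_best; case: pselect => [h|[]]; last by apply: best_exists; exists x.
by exists (projT1 (cid h)) => //; case: (cid h) => y [_ H] /=; apply: H.
Qed.

(** If [x] ever ceases to be a candidate, the element selected at that moment is near [x] and was
    chosen with [x] still competing. Otherwise [x] competes at every step, so every selected size is
    at least half of its own. *)
Lemma greedy_cover : exists o : nat -> option T,
  [/\ forall i x, o i = Some x -> V x,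
      forall i j x y, (i < j)%N -> o i = Some x -> o j = Some y -> ~ near_ y x
    & forall x, V x ->
      (exists i y, [/\ o i = Some y, near_ x y & r x <= 2 * r y]) \/
      (forall i, exists2 y, o i = Some y & r x <= 2 * r y)].
Proof.
exists (fun i => pick_best (greedy i)); split.
- by move=> i x /pick_bestP [[]].
- move=> i j x y ij ix /pick_bestP [[_ H] _]; apply: H.
  elim: j ij => // j IH; rewrite ltnS leq_eqVlt => /orP[/eqP <-|/IH xj] /=.
    by rewrite ix mem_head.
  by case: pick_best => // z; rewrite inE xj orbT.
move=> x Vx; have [all|] := pselect (forall i, candidate (greedy i) x).
  by right=> i; apply: pick_best_cand.
move=> /existsNP ex; left.
have ex' : exists i, ~~ `[< candidate (greedy i) x >].
  by case: ex => i H; exists i; apply/asboolP.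
case: (ex_minnP ex') => -[|i] /asboolP ni imin; first by case: ni; split.
have ci : candidate (greedy i) x.
  apply: contrapT => H; have nc : ~~ `[< candidate (greedy i) x >] by apply/negP => /asboolP.
  have := imin i nc.
  by rewrite ltnn.
have [y iy ry] := pick_best_cand _ _ ci.
exists i, y; split=> //; apply: contrapT => nxy; apply: ni; split=> // z.
by rewrite /= iy inE => /orP[/eqP -> //|]; case: ci => _; apply.
Qed.

End Greedy.

(** * Regular points, packing bounds and points of unbounded density *)

Section Density.
Context {R : realType} {n' : nat}.
Let n := n'.+1.
Implicit Types (E : set 'rV[R]_n) (x y : 'rV[R]_n).

Definition regular_at (t : R) E (c : R) x :=
  (forall r, 0 < r <= 1 ->
    ((c^-1 * r `^ t)%:E <= hausdorff t (E `&` eclosed_ball x r))%E) /\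
  (forall r, 0 < r -> (hausdorff t (E `&` eclosed_ball x r) <= (c * r `^ t)%:E)%E).

Lemma balls_apart x y (e r s : R) z w :
  apart e x y -> eclosed_ball x r z -> eclosed_ball y s w -> e - r - s <= enorm (z - w).
Proof.
move=> /existsP [i ei] zr ws.
have := le_trans (coord_le_enorm (z - x) i) zr.
have := le_trans (coord_le_enorm (w - y) i) ws.
have := coord_le_enorm (z - w) i; rewrite !mxE => h1 h2 h3.
have : `|x 0 i - y 0 i| <= `|z 0 i - x 0 i| + `|z 0 i - w 0 i| + `|w 0 i - y 0 i|.
  rewrite (_ : x 0 i - y 0 i = - (z 0 i - x 0 i) + (z 0 i - w 0 i) + (w 0 i - y 0 i)); last by ring.
  by apply: le_trans (ler_normD _ _) _; rewrite lerD2r; apply: le_trans (ler_normD _ _) _; rewrite normrN.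
lra.
Qed.

(** Balls of radius [e / 3] about the points are separated by [e / 3], have mass at least
    [c^-1 (e/3)^t], and lie in one ball of radius [2 n r] about the first point. Comparing masses
    gives the constant [c^2 (6 n)^t]. *)
Lemma regular_packing {T : Type} (X : T -> 'rV[R]_n) (t : R) E (c : R) :
  0 <= t -> 0 < c -> (forall a, regular_at t E c (X a)) -> packing t X.
Proof.
move=> t0 c0 reg; exists (c * (c * (6 * n%:R) `^ t)).
  by rewrite !mulr_ge0 ?powR_ge0 ?(ltW c0).
move=> e r s /andP[e0 e1] er sa sc.
have r0 : 0 < r by apply: lt_le_trans er.
case: s sa sc => [|a0 s0] sa sc.
  by rewrite !mulr_ge0 ?powR_ge0 ?(ltW c0).
set s := a0 :: s0 in sa sc *.
pose x i := X (nth a0 s i).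
pose S i := E `&` eclosed_ball (x i) (e / 3).
have e3 : 0 < e / 3 by rewrite divr_gt0.
have sep i j z w : (i < j < size s)%N -> S i z -> S j w -> e / 3 <= enorm (z - w).
  move=> /andP[ij js] [_ zi] [_ wj].
  have xij : apart e (x i) (x j).
    by have /(pairwiseP a0) := sa; apply; rewrite ?inE // (ltn_trans ij).
  have := balls_apart _ _ _ _ _ _ _ xij zi wj; lra.
have sum_le := hausdorff_separated_sum t (e / 3) S (size s) e3 sep.
have : (((size s)%:R * (c^-1 * (e / 3) `^ t))%:E <= (c * (2 * n%:R * r) `^ t)%:E)%E.
  apply: le_trans (_ : _ <= \sum_(0 <= i < size s) hausdorff t (S i))%E _.
    rewrite mulr_natl big_mkord.
    apply: (@le_trans _ _ (\sum_(i < size s) (c^-1 * (e / 3) `^ t)%:E)%E).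
      by rewrite sumEFin lee_fin sumr_const card_ord.
    apply: lee_sum => i _; have [low _] := reg (nth a0 s i); apply: low.
    by rewrite e3 /=; lra.
  apply: le_trans sum_le _.
  have [_ up] := reg a0; apply: le_trans (up (2 * n%:R * r) _); last first.
    by rewrite !mulr_gt0 // ltr0n.
  apply: hausdorff_subset => z [i is_ [Ez zi]]; split=> //=.
  rewrite /eclosed_ball /=; apply: le_trans (enorm_le_lnorm _) _.
  rewrite [2 * _]mulrC -mulrA; apply: lnorm_le_coord => k.
  rewrite !mxE; have := le_trans (coord_le_enorm (z - x i) k) zi; rewrite !mxE => h1.
  have h2 : `|x i 0 k - X a0 0 k| <= r.
    have [->|i0] := posnP i; first by rewrite subrr normr0 ltW.
    have /(pairwiseP a0) := sc => /(_ 0%N i isT is_ i0) /forallP /(_ k).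
    by rewrite distrC.
  apply: le_trans (ler_distD (x i 0 k) _ _) _; lra.
rewrite lee_fin => H.
have ep0 : 0 < c^-1 * (e / 3) `^ t by rewrite mulr_gt0 ?invr_gt0 // powR_gt0.
rewrite -(ler_pM2r ep0); apply: le_trans H _.
have -> : c * (c * (6 * n%:R) `^ t) * (r / e) `^ t * (c^-1 * (e / 3) `^ t) =
    c * ((6 * n%:R) `^ t * (r / e) `^ t * (e / 3) `^ t).
  by field; rewrite gt_eqF.
have [r_ge0 e_ge0] := (ltW r0, ltW e0).
rewrite -!powRM ?mulr_ge0 ?invr_ge0 //.
suff -> : 6 * n%:R * (r / e) * (e / 3) = 2 * n%:R * r by [].
by field; rewrite gt_eqF.
Qed.

Definition upper_unbounded (t : R) E : set 'rV[R]_n :=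
  [set x | E x /\ forall C, exists2 r, 0 < r &
    ((C * r `^ t)%:E < hausdorff t (E `&` eclosed_ball x r))%E].

Lemma upper_unbounded_null (t : R) E : 0 <= t -> (hausdorff t E < +oo)%E ->
  hausdorff t (upper_unbounded t E) = 0%E.
Proof.
move=> t0 Efin.
pose mu := fine (hausdorff t E).
have muE : hausdorff t E = mu%:E.
  by rewrite fineK // ge0_fin_numE ?hausdorff_ge0.
have mu0 : 0 <= mu by rewrite -lee_fin -muE hausdorff_ge0.
have ball_le x r : (hausdorff t (E `&` eclosed_ball x r) <= mu%:E)%E.
  by rewrite -muE; apply: hausdorff_subset => y [].
have [t00|tn0] := eqVneq t 0.
  rewrite (_ : upper_unbounded t E = set0) ?hausdorff_set0 //.
  apply/seteqP; split=> // x [_ /(_ mu) [r _]].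
  by rewrite t00 powRr0 mulr1 -t00 => /lt_le_trans /(_ (ball_le x r)); rewrite ltxx.
have tp : 0 < t by rewrite lt0r tn0.
apply/hausdorff_eq0 => d e d0 e0.
pose q : R := n%:R * 12; have q0 : 0 < q by rewrite mulr_gt0 // ltr0n.
(* The first summand makes the total of the cover at most [e]; the second forces the radii below
   [d / q], hence the diameters below [d]. *)
pose C := (mu + 1) * (q `^ t / e + (q / d) `^ t).
have mu1 : 0 < mu + 1 by rewrite ltr_wpDl.
have C0 : 0 < C.
  by rewrite mulr_gt0 // addr_gt0 // ?divr_gt0 ?powR_gt0 // divr_gt0.
have [rad radP] : exists rad : 'rV[R]_n -> R, forall x, upper_unbounded t E x ->
    0 < rad x /\ ((C * rad x `^ t)%:E < hausdorff t (E `&` eclosed_ball x (rad x)))%E.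
  have : forall x, exists r : R, upper_unbounded t E x ->
      0 < r /\ ((C * r `^ t)%:E < hausdorff t (E `&` eclosed_ball x r))%E.
    move=> x; have [[_ /(_ C) [r r0 Hr]]|nx] := pselect (upper_unbounded t E x).
      by exists r.
    by exists 0.
  by move=> /choice [rad H]; exists rad.
have [q_ge0 d_ge0 C_ge0] : [/\ 0 <= q, 0 <= d & 0 <= C] by split; exact: ltW.
have rad_small x : upper_unbounded t E x -> q * rad x <= d.
  move=> /radP [r0 Hr]; have := lt_le_trans Hr (ball_le _ _); rewrite lte_fin => Crt.
  rewrite -ler_pdivlMl // mulrC leNgt; apply/negP => dr.
  move: Crt; apply/negP; rewrite -leNgt.
  apply: (@le_trans _ _ (C * (d / q) `^ t)); last first.
    by rewrite ler_wpM2l ?(ltW C0) //; apply: ler_powR_base => //; [exact: divr_ge0|exact: ltW].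
  apply: (@le_trans _ _ ((mu + 1) * (q / d) `^ t * (d / q) `^ t)).
    rewrite -mulrA -powRM ?divr_ge0 // mulrA divfK ?gt_eqF // divff ?gt_eqF //.
    by rewrite powR1 mulr1 lerDl.
  rewrite ler_wpM2r ?powR_ge0 // /C ler_wpM2l ?(ltW mu1) // lerDr.
  by rewrite divr_ge0 ?powR_ge0 // ltW.
(* Points that are not near have balls at distance at least [rad x + rad y]; a near [x] with
   [rad x <= 2 * rad y] lies within [6 * rad y] of [y], which explains the enlargement in [U] and
   the 12 in [q]. *)
pose nr x y := close (2 * (rad x + rad y)) x y.
have rad_le x : upper_unbounded t E x -> rad x <= d / q.
  by move=> ux; rewrite ler_pdivlMr // mulrC rad_small.
have [ o [oV osep ocov]] := greedy_cover (upper_unbounded t E) rad (d / q) nr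
  (fun x ux => (radP x ux).1) rad_le.
pose U i := if o i is Some y then [set z | close (6 * rad y) z y] else set0.
pose S i := if o i is Some y then E `&` eclosed_ball y (rad y) else set0.
have Ssum N : (\sum_(0 <= i < N) hausdorff t (S i) <= mu%:E)%E.
  (* The least of finitely many radii serves as a common separation. *)
  have [g g0 gsep] : exists2 g : R, 0 < g & forall i y, (i < N)%N -> o i = Some y -> g <= rad y.
    elim: N => [|N [g g0 IH]]; first by exists 1.
    case oN : (o N) => [y|]; last first.
      exists g => // i y; rewrite ltnS leq_eqVlt => /orP[/eqP ->|/IH]; last exact.
      by rewrite oN.
    exists (Num.min g (rad y)); first by rewrite lt_min g0; case: (radP _ (oV _ _ oN)).
    move=> i z; rewrite ltnS leq_eqVlt => /orP[/eqP ->|iN oi].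
      by rewrite oN => -[<-]; rewrite ge_min lexx orbT.
    by rewrite ge_min (IH i z).
  apply: le_trans (hausdorff_separated_sum t g S N g0 _) _; last first.
    rewrite -muE; apply: hausdorff_subset => z [i _]; rewrite /S.
    by case: (o i) => // y [].
  move=> i j z w /andP[ij jN]; rewrite /S.
  case oi : (o i) => [x|] //; case oj : (o j) => [y|] // [_ zx] [_ wy].
  have nxy := osep _ _ _ _ ij oi oj.
  have ap : apart (2 * (rad x + rad y)) x y.
    have /negP := nxy; rewrite negb_forall => /existsP [k]; rewrite -ltNge => k1.
    by apply/existsP; exists k; rewrite distrC addrC ltW.
  have := balls_apart _ _ _ _ _ _ _ ap zx wy.
  have := gsep i x (ltn_trans ij jN) oi.
  have [ry _] := radP _ (oV _ _ oj); lra.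
exists U; split.
- move=> i; rewrite /U; case oi : (o i) => [y|]; last by rewrite ediam_set0 leNye.
  apply: le_trans (ediam_le _ (6 * rad y) y _) _ => //.
  rewrite lee_fin; have := rad_small _ (oV _ _ oi); rewrite /q; lra.
- move=> x ux; have [[i [y [oi xy rxy]]]|inf] := ocov _ ux.
    exists i => //; rewrite /U oi /=; apply: close_le xy; lra.
  (* An endless selection of balls of radius at least [rad x / 2] would have mass at least [k] each,
     exceeding the finite total [mu]. *)
  exfalso; have [rx _] := radP _ ux.
  pose k := C * (rad x / 2) `^ t.
  have k0 : 0 < k by rewrite mulr_gt0 ?powR_gt0 // divr_gt0.
  pose N := Num.bound (mu / k).
  have := archi_boundP (divr_ge0 mu0 (ltW k0)); rewrite -/N ltr_pdivrMr // => muN.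
  suff : ((N%:R * k)%:E <= mu%:E)%E by rewrite lee_fin leNgt muN.
  apply: le_trans (Ssum N); rewrite mulr_natl big_mkord.
  apply: (@le_trans _ _ (\sum_(i < N) k%:E)%E); first by rewrite sumEFin lee_fin sumr_const card_ord.
  apply: lee_sum => i _; have [y oi rxy] := inf i; rewrite /S oi.
  have [ry /ltW] := radP _ (oV _ _ oi); apply: le_trans; rewrite lee_fin.
  rewrite /k ler_wpM2l ?(ltW C0) //; apply: ler_powR_base => //.
    by rewrite divr_ge0 // ltW.
  by rewrite ler_pdivrMr // mulrC.
move=> N; have qC : 0 <= q `^ t / C by rewrite divr_ge0 ?powR_ge0.
apply: (@le_trans _ _ (\sum_(0 <= i < N) (q `^ t / C)%:E * hausdorff t (S i))%E).
  apply: lee_sum => i _; rewrite /U /S; case oi : (o i) => [y|]; last first.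
    by rewrite diam_power_set0 mule_ge0 // hausdorff_ge0.
  have [ry /ltW Hy] := radP _ (oV _ _ oi).
  apply: le_trans (diam_power_le _ t (6 * rad y) y t0 _ _) _ => //.
    by rewrite mulr_ge0 // ltW.
  apply: (@le_trans _ _ ((q `^ t / C)%:E * (C * rad y `^ t)%:E)%E); last by rewrite lee_wpmul2l.
  rewrite -EFinM lee_fin [leRHS]mulrA divfK ?gt_eqF // -powRM ?(ltW ry) //.
  by apply: ler_powR_base; rewrite // ?mulr_ge0 ?(ltW ry) // /q; lra.
rewrite -ge0_sume_distrr; last by move=> i _; apply: hausdorff_ge0.
apply: (@le_trans _ _ ((q `^ t / C)%:E * mu%:E)%E); first by rewrite lee_wpmul2l.
rewrite -EFinM lee_fin mulrAC ler_pdivrMr //.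
apply: (@le_trans _ _ (e * ((mu + 1) * (q `^ t / e)))); last first.
  by rewrite ler_wpM2l ?(ltW e0) // ler_wpM2l ?(ltW mu1) // lerDl powR_ge0.
have -> : e * ((mu + 1) * (q `^ t / e)) = q `^ t * (mu + 1) by field; rewrite gt_eqF.
by rewrite ler_wpM2l ?powR_ge0 // lerDl.
Qed.

End Density.

Lemma lower_density_gt0 {R : realType} {n : nat} (t : R) (E : set 'rV[R]_n) x :
  (0 < lower_density t E x)%E -> exists c d : R, [/\ 0 < c, 0 < d &
    forall r, 0 < r < d -> ((c * r `^ t)%:E <= hausdorff t (E `&` eclosed_ball x r))%E].
Proof.
rewrite /lower_density limf_einfE => /ereal_sup_gt [_ [V V0 <-] infV].
have [c c0 cV] : exists2 c : R, 0 < c &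
    (c%:E <= ereal_inf [set (hausdorff t (E `&` eclosed_ball x r) * ((r `^ t)^-1)%:E)%E | r in V])%E.
  case: (ereal_inf _) infV => [c| |] //; first by rewrite lte_fin => c0; exists c.
  by move=> _; exists 1; rewrite // leey.
have [d /= d0 dV] : \forall r \near (0:R), 0 < r -> V r by exact: V0.
exists c, d; split=> // r /andP[r0 rd].
have rt0 : 0 < r `^ t by rewrite powR_gt0.
have Vr : V r by apply: dV => //=; rewrite /ball /= sub0r normrN gtr0_norm.
have : (c%:E <= hausdorff t (E `&` eclosed_ball x r) * ((r `^ t)^-1)%:E)%E.
  by apply: le_trans cV _; apply: ereal_inf_lbound; exists r.
by rewrite EFinM -lee_pdivlMr // invrK.
Qed.

(** Off two null sets, a point has positive lower density and bounded mass ratios; a single index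
    [j] dominates its norm and both of its constants. *)
Lemma regular_pieces {R : realType} {n' : nat} (t : R) (E : set 'rV[R]_n'.+1) :
  0 <= t -> (hausdorff t E < +oo)%E ->
  hausdorff_ae_in t E (fun x => (0 < lower_density t E x)%E) ->
  exists A : nat -> set 'rV[R]_n'.+1, hausdorff t (E `\` \bigcup_j A j) = 0%E /\
    forall j x, A j x -> close j%:R x 0 /\ regular_at t E j.+1%:R x.
Proof.
move=> t0 Efin dens.
exists (fun j => [set x | close j%:R x 0 /\ regular_at t E j.+1%:R x]); split; last by [].
apply/eqP; rewrite eq_le hausdorff_ge0 andbT.
rewrite -(hausdorff_null_setU _ _ _ dens (upper_unbounded_null t E t0 Efin)).
apply: hausdorff_subset => x [Ex nA].
have [low|nlow] := pselect (0 < lower_density t E x)%E; last by left.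
right; split=> // C; apply: contrapT => bounded; apply: nA.
have [c [d [c0 d0 lowc]]] := lower_density_gt0 _ _ _ low.
have up r : 0 < r -> (hausdorff t (E `&` eclosed_ball x r) <= (C * r `^ t)%:E)%E.
  by move=> r0; rewrite leNgt; apply/negP => H; apply: bounded; exists r.
pose d' := Num.min (d / 2) 1.
have d'0 : 0 < d' by rewrite lt_min divr_gt0 //=.
have d'1 : d' <= 1 by rewrite ge_min lexx orbT.
have d'd : d' < d by rewrite gt_min; apply/orP; left; lra.
pose c' := c * d' `^ t.
have c'0 : 0 < c' by rewrite mulr_gt0 // powR_gt0.
(* The density bound holds below [d] only; shrinking the radius by [d'] carries it to all radii up
   to 1, at the cost of the factor [d'^t]. *)
have low' r : 0 < r <= 1 -> ((c' * r `^ t)%:E <= hausdorff t (E `&` eclosed_ball x r))%E.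
  move=> /andP[r0 r1]; pose r' := d' * r.
  have r'0 : 0 < r' by rewrite mulr_gt0.
  have r'd : r' < d by apply: le_lt_trans d'd; rewrite ler_piMr // ltW.
  apply: le_trans (_ : _ <= hausdorff t (E `&` eclosed_ball x r'))%E _.
    by rewrite /c' -mulrA -powRM ?(ltW d'0) ?(ltW r0) // lowc // r'0.
  apply: hausdorff_subset => y [Ey]; rewrite /eclosed_ball /= => yr'; split=> //=.
  by apply: le_trans yr' _; rewrite ler_piMl // ltW.
pose M := Num.max C (Num.max c'^-1 (lnorm x)).
have M0 : 0 <= M by rewrite !le_max lnorm_ge0 !orbT.
pose j := Num.bound M.
have Mj : M <= j%:R by apply: ltW; apply: archi_boundP.
have jS : j%:R <= j.+1%:R :> R by rewrite ler_nat.
exists j => //=; split.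
  apply/forallP => i; rewrite mxE subr0; apply: le_trans (coord_le_lnorm x i) _.
  by apply: le_trans Mj; rewrite !le_max lexx !orbT.
split=> r.
  move=> r01; apply: le_trans (low' r r01); rewrite lee_fin ler_wpM2r ?powR_ge0 //.
  rewrite -[leRHS]invrK lef_pV2 ?posrE ?invr_gt0 ?ltr0Sn //; apply: le_trans jS.
  by apply: le_trans Mj; rewrite !le_max lexx !orbT.
move=> r0; apply: le_trans (up r r0) _; rewrite lee_fin ler_wpM2r ?powR_ge0 //.
by apply: le_trans jS; apply: le_trans Mj; rewrite !le_max lexx.
Qed.

(** * Assembly over the countable family of pieces *)

Lemma hausdorff_cover_null {R : realType} {n : nat} (t : R) (E : set 'rV[R]_n)
    (A G : nat -> set 'rV[R]_n) : hausdorff t (E `\` \bigcup_j A j) = 0%E ->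
  (forall j, A j `<=` G j) -> hausdorff t (E `\` \bigcup_j G j) = 0%E.
Proof.
move=> EA AG; apply/eqP; rewrite eq_le hausdorff_ge0 andbT -EA.
apply: hausdorff_subset => x [Ex nG]; split=> // -[j _ Ax]; apply: nG.
by exists j => //; apply: AG.
Qed.

(** Serves at the indices whose piece is empty. *)
Lemma point_holder_cube {R : realType} {n : nat} (m : nat) (al : R) :
  holder_cube m al (set1 (0 : 'rV[R]_n)).
Proof.
exists (fun=> 0); split.
  apply: (@le_lt_trans _ _ 0%:E); last exact: ltry.
  apply: ge_ereal_sup => _ [[z w] _ <-] /=; rewrite lee_fin subrr.
  suff -> : enorm (0 : 'rV[R]_n) = 0 by rewrite mul0r.
  by rewrite /enorm big1 ?sqrtr0 // => i _; rewrite mxE expr0n.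
apply/seteqP; split=> [_ -> /=|_ [z _ <-] //].
by exists 0 => // i; rewrite mxE lexx ler01.
Qed.

(** Serves at the indices whose piece is empty. *)
Lemma segment_bilipschitz {R : realType} {n' : nat} :
  bilipschitz_embedding (fun r : R => \row_(i < n'.+1) (if i == ord0 then r else 0)).
Proof.
exists 1; split=> // x y _ _; rewrite invr1 !mul1r.
suff -> : enorm (\row_(i < n'.+1) (if i == ord0 then x else 0) -
    \row_(i < n'.+1) (if i == ord0 then y else 0)) = `|x - y| by rewrite lexx.
rewrite /enorm (bigD1 ord0) //= !mxE eqxx big1 ?addr0 ?sqrtr_sqr // => i /negbTE i0.
by rewrite !mxE i0 subrr expr0n.
Qed.

Theorem theorem1p7 (R : realType) (m n : nat) (s t : R) (E : set 'rV[R]_n)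
    (hmn : (1 <= m <= n - 1)%N) (hs : m%:R <= s <= n%:R) (ht : 0 <= t < s)
    (hE : t_set t E)
    (hdens : hausdorff_ae_in t E (fun x => (0 < lower_density t E x)%E)) :
  countably_holder_rectifiable t m s E /\
  (0 <= t < 1 -> countably_bilipschitz_rectifiable t E).
Proof.
case: n => [|n'] in E hmn hs hE hdens *; first by case: m hmn {hs}.
case: m => [|m'] in hmn hs *; first by [].
have [_ _ Efin] := hE; have /andP[ms _] := hs; have /andP[t0 _] := ht.
have [A [EA AP]] := regular_pieces t E t0 Efin hdens.
pose X j : {x | A j x} -> 'rV[R]_n'.+1 := @proj1_sig _ _.
(* Using [j.+1] keeps the bound positive at [j = 0], as [bilipschitz_piece] demands. *)
have Xclose j a b : close (2 * j.+1%:R) (X j a) (X j b).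
  have [/forallP ca _] := AP j _ (proj2_sig a); have [/forallP cb _] := AP j _ (proj2_sig b).
  apply/forallP => i; have := ca i; have := cb i; rewrite !mxE !subr0 => hb ha.
  apply: le_trans (ler_normB _ _) _.
  have : j%:R <= j.+1%:R :> R by rewrite ler_nat.
  by move: hb ha; rewrite /X; lra.
have Xpack j : packing t (X j).
  apply: (@regular_packing _ _ _ (X j) t E j.+1%:R t0); first by rewrite ltr0Sn.
  by move=> a; have [] := AP j _ (proj2_sig a).
split=> [|t01].
  have : forall j, exists G, holder_cube m'.+1 (m'.+1%:R / s) G /\ A j `<=` G.
    move=> j; have [[x0 Ax0]|/set0P/negP/negPn/eqP A0] := pselect (A j !=set0); last first.
      by exists [set 0]; split; [exact: point_holder_cube|rewrite A0].
    have [G Ghol GX] := holder_piece (X j) (exist _ x0 Ax0) _ t s ht ms (Xclose j) (Xpack j).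
    by exists G; split=> // x Ax; exact: (GX (exist _ x Ax)).
  move=> /choice [G GP]; exists G; split; first by move=> i; case: (GP i).
  by apply: hausdorff_cover_null EA _ => j; case: (GP j).
have : forall j, exists f : R -> 'rV[R]_n'.+1,
    bilipschitz_embedding f /\ A j `<=` f @` `[0, 1].
  move=> j; have [[x0 Ax0]|/set0P/negP/negPn/eqP A0] := pselect (A j !=set0); last first.
    by eexists; split; [exact: segment_bilipschitz|rewrite A0].
  have Xinj : injective (X j).
    by move=> [x Ax] [y Ay] /= xy; apply: eq_exist.
  have K0 : 0 < 2 * j.+1%:R :> R by rewrite mulr_gt0 // ltr0Sn.
  have [f fbil fX] := bilipschitz_piece (X j) (exist _ x0 Ax0) _ t Xinj t01 K0
    (Xclose j) (Xpack j).
  by exists f; split=> // x Ax; exact: (fX (exist _ x Ax)).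
move=> /choice [f fP]; exists f; split; first by move=> i; case: (fP i).
by apply: hausdorff_cover_null EA _ => j; case: (fP j).
Qed.
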